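(* Consider a rank-$K$ maxout network, $K\ge 2$, with $n_0$ inputs, $n_1$ units in the first layer, and any number of additional layers of nonzero width. Then for almost every choice of the parameters (with respect to Lebesgue measure), the represented function has at least $\sum_{j=0}^{n_0}\binom{n_1}{j}$ linear regions, and at least $\binom{n_1-1}{n_0}$ bounded linear regions.
   Context: A rank-$K$ maxout unit with $n$ inputs computes $y\mapsto\max_{k\in[K]}\{w_k\cdot y+b_k\}$ with trainable $w_k\in\mathbb{R}^n$, $b_k\in\mathbb{R}$. A fully connected feedforward maxout network with $n_0$ inputs composes layers $\phi_l:\mathbb{R}^{n_{l-1}}\to\mathbb{R}^{n_l}$ whose coordinates are rank-$K$ maxout units, followed by a linear output layer. A linear region of a piecewise linear function on $\mathbb{R}^{n_0}$ is a maximal connected subset of $\mathbb{R}^{n_0}$ on which the function has constant gradient. *)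

(* Defs.v *)
From HB Require Import structures.
From mathcomp Require Import all_boot all_order all_algebra.
From mathcomp Require Import all_classical all_reals all_analysis.
Set Implicit Arguments. Unset Strict Implicit. Unset Printing Implicit Defensive.
Import Order.TTheory GRing.Theory Num.Theory.
Import numFieldNormedType.Exports.
Local Open Scope classical_set_scope.
Local Open Scope ring_scope.

Section Maxout.
Variable R : realType.

Definition maxl (s : seq R) : R :=
  if s is a :: s' then foldr Num.max a s' else 0.

Definition dotl (w : nat -> R) (x : seq R) : R :=
  \sum_(i < size x) w i * nth 0 x i.

(** One maxout layer with [nout] rank-[K] units applied to input [x]
    (of width [size x]).  Parameters are read from [th] starting at offset [o]:
    piece [k] of unit [j] has weights th(o + (j*K+k)*(nin+1) + i), i < nin,
    and bias th(o + (j*K+k)*(nin+1) + nin). *)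
Definition layer_eval (K : nat) (th : nat -> R) (o nout : nat) (x : seq R)
  : seq R :=
  [seq maxl [seq dotl (fun i => th (o + (j * K + k) * (size x).+1 + i)%N) x
                 + th (o + (j * K + k) * (size x).+1 + size x)%N
            | k <- iota 0 K]
  | j <- iota 0 nout].

Fixpoint net_eval (K : nat) (th : nat -> R) (o : nat) (ws : seq nat)
  (x : seq R) : R :=
  match ws with
  | [::] => dotl (fun i => th (o + i)%N) x + th (o + size x)%N
  | n :: ws' => net_eval K th (o + n * K * (size x).+1)%N ws'
                         (layer_eval K th o n x)
  end.

(** Coordinate k of a parameter vector (0 out of range, never used). *)
Definition coord (D : nat) (theta : 'rV[R]_D) (k : nat) : R :=
  match @insub nat (fun k => (k < D)%N) 'I_D k with
  | Some i => theta 0 i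
  | None => 0
  end.

Definition maxout_net (K n0 : nat) (ws : seq nat)
  (D : nat) (theta : 'rV[R]_D) : 'rV[R]_n0 -> R :=
  fun x => net_eval K (coord theta) 0 ws [seq x 0 i | i <- enum 'I_n0].

End Maxout.
Arguments maxout_net {R} K n0 ws {D} theta _.

Fixpoint nparams (K nin : nat) (ws : seq nat) : nat :=
  match ws with
  | [::] => nin.+1
  | n :: ws' => (n * K * nin.+1 + nparams K n ws')%N
  end.

Section Regions.
Variable R : realType.

Definition has_grad (n : nat) (f : 'rV[R]_n -> R) (x g : 'rV[R]_n) : Prop :=
  differentiable f x /\ forall v : 'rV[R]_n, 'D_v f x = \sum_i g 0 i * v 0 i.

Definition const_grad (n : nat) (f : 'rV[R]_n -> R) (U : set 'rV[R]_n) : Prop :=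
  exists g : 'rV[R]_n, forall x, U x -> has_grad f x g.

Definition linear_region (n : nat) (f : 'rV[R]_n -> R) (U : set 'rV[R]_n)
  : Prop :=
  U !=set0 /\ connected U /\ const_grad f U /\
  forall V : set 'rV[R]_n, U `<=` V -> connected V -> const_grad f V -> V = U.

Definition bounded_rset (n : nat) (U : set 'rV[R]_n) : Prop :=
  exists M : R, forall x, U x -> forall i, `|x 0 i| <= M.

Definition at_least_regions (n : nat) (f : 'rV[R]_n -> R) (N : nat) : Prop :=
  exists r : 'I_N -> set 'rV[R]_n, injective r /\ forall i, linear_region f (r i).

Definition at_least_bounded_regions (n : nat) (f : 'rV[R]_n -> R) (N : nat)
  : Prop :=
  exists r : 'I_N -> set 'rV[R]_n, injective r /\
    forall i, linear_region f (r i) /\ bounded_rset (r i).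

Definition box (n : nat) (a b : 'rV[R]_n) : set 'rV[R]_n :=
  [set x | forall i, a 0 i <= x 0 i <= b 0 i].

Definition lebesgue_null (n : nat) (N : set 'rV[R]_n) : Prop :=
  forall eps : R, 0 < eps ->
    exists a b : nat -> 'rV[R]_n,
      (forall k i, a k 0 i <= b k 0 i) /\
      N `<=` \bigcup_k box (a k) (b k) /\
      forall m, \sum_(k < m) \prod_i (b k 0 i - a k 0 i) <= eps.

Definition ae_leb (n : nat) (P : 'rV[R]_n -> Prop) : Prop :=
  exists N : set 'rV[R]_n, lebesgue_null N /\ forall x, ~ P x -> N x.

End Regions.

(* Main.v *)
(** It suffices to find many cells of the arrangement formed by the first layer:
    for almost every parameter the gradients of the network along two activation
    patterns that differ in the first layer are different, so every point where
    the network has the gradient of a pattern lies in the closed first-layer cell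
    of that pattern, and each nonempty cell contains a linear region of its own.

    To count cells, call a unit tied at a point if two of its affine pieces are
    maximal there.  Any [d] generic units in dimension [d] are tied at a common
    point: minimize a difference of two pieces of the last unit over the polyhedral
    complex [T] where the others are tied; at a minimizer, genericity provides a
    direction inside [T] along which this difference decreases, so the last unit
    must be tied somewhere on [T].  Around such a point all choices of tied pieces
    occur as cells, i.e. every set of at most [d] units is strongly shattered by the
    set of cells, and a family always has at least as many members as strongly
    shattered sets.  For bounded cells, attach to every tie point of [d] units other
    than unit [m] the cell on whose cone a difference of two pieces of [m] is maximal
    at that point; it is cut down to a subset of a simplex by the cell of [m].

    Null sets come from one principle: if [f] is affine in one parameter with slope
    [a], and [a] is almost everywhere nonzero, then the zero set of [f] is a
    countable union of Lipschitz graphs over the other parameters. *)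
Require Import Defs.
From HB Require Import structures.
From mathcomp Require Import all_boot all_order all_algebra.
From mathcomp Require Import all_classical all_reals all_analysis.
From mathcomp Require Import ring lra.
Set Implicit Arguments. Unset Strict Implicit. Unset Printing Implicit Defensive.
Import Order.TTheory GRing.Theory Num.Theory.
Import numFieldNormedType.Exports.

(** * Strongly shattered sets *)

(** Strong shattering for functions with values in any finite type. The coercion of [b] to 0 or 1
    asks for two values at the indices marked by [m] and for one value elsewhere. *)
Definition shattered (T : finType) (n : nat) (F : pred (n.-tuple T))
    (m : n.-tuple bool) : bool :=
  [exists A : n.-tuple {set T},
    all2 (fun (b : bool) (S : {set T}) => b < #|S|) m A &&
    [forall t : n.-tuple T, all2 (fun x (S : {set T}) => x \in S) t A ==> F t]].

Lemma sum_tuple_cons (T : finType) n (G : n.+1.-tuple T -> nat) :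
  \sum_t G t = \sum_x \sum_(t : n.-tuple T) G (cons_tuple x t).
Proof.
rewrite pair_big /=.
rewrite (reindex (fun p : T * n.-tuple T => cons_tuple p.1 p.2)) //=.
exists (fun t : n.+1.-tuple T => (thead t, behead_tuple t)).
  by case=> x t _ /=; congr pair; apply: val_inj.
by move=> t _ /=; apply: val_inj; rewrite /= [in RHS](tuple_eta t).
Qed.

Lemma card_shattered (T : finType) n (F : pred (n.-tuple T)) :
  \sum_(m : n.-tuple bool) shattered F m <= \sum_(t : n.-tuple T) F t.
Proof.
elim: n F => [|n IHn] F.
  have one (S : finType) : (fun=> true) =1 pred1 ([tuple] : 0.-tuple S).
    by move=> m; rewrite (tuple0 m) /= eqxx.
  rewrite !(big_pred1 _ (one _)).
  case: (boolP (shattered F _)) => //= /existsP[A /andP[_ /forallP/(_ [tuple])]].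
  by rewrite (tuple0 A) /= => ->.
(* A set avoiding the first index is shattered by the projection [F1] of [F]; one
   containing it comes from a set shattered by the doubly covered part [F2]. *)
pose F1 (t : n.-tuple T) := [exists x, F (cons_tuple x t)].
pose F2 (t : n.-tuple T) :=
  [exists x, exists y, [&& x != y, F (cons_tuple x t) & F (cons_tuple y t)]].
have shF1 (m : n.-tuple bool) :
    shattered F (cons_tuple false m) -> shattered F1 m.
  case/existsP=> A; case/tupleP: A => S B /= /andP[/andP[/card_gt0P[x xS] mB]].
  move=> /forallP AF; apply/existsP; exists B; rewrite mB /=.
  apply/forallP=> t; apply/implyP=> tB; apply/existsP; exists x.
  by have /implyP := AF (cons_tuple x t); apply; rewrite /= xS.
have shF2 (m : n.-tuple bool) :
    shattered F (cons_tuple true m) -> shattered F2 m.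
  case/existsP=> A; case/tupleP: A => S B /= /andP[/andP[/card_gt1P[x [y [xS yS xy]]] mB]].
  move=> /forallP AF; apply/existsP; exists B; rewrite mB /=.
  apply/forallP=> t; apply/implyP=> tB; apply/existsP; exists x.
  apply/existsP; exists y; rewrite xy /=.
  have /implyP Fx := AF (cons_tuple x t); have /implyP Fy := AF (cons_tuple y t).
  by rewrite Fx ?Fy //= ?xS ?yS.
rewrite !sum_tuple_cons big_bool /=.
rewrite [leqRHS]exchange_big /=.
apply: (@leq_trans (\sum_(t : n.-tuple T) F2 t + \sum_(t : n.-tuple T) F1 t)).
  apply: leq_add; apply: leq_trans (IHn _); apply: leq_sum => m _.
    by case: (boolP (shattered F _)) => // /shF2 ->.
  by case: (boolP (shattered F _)) => // /shF1 ->.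
(* A tail counted by [F2] has two extensions in [F], and one counted only by [F1] has at least
   one. *)
rewrite -big_split; apply: leq_sum => t _ /=.
case: (boolP (F2 t)) => [/existsP[x /existsP[y /and3P[xy Fx Fy]]]|_].
  rewrite (bigD1 x) //= (bigD1 y) //= 1?eq_sym // Fx Fy.
  by rewrite addnA (leq_trans _ (leq_addr _ _)) // ltnS leq_b1.
case: (boolP (F1 t)) => [/existsP[x Fx]|//].
by rewrite (bigD1 x) //= Fx leq_addr.
Qed.

Lemma card_subsets_le n d :
  #|[set J : {set 'I_n} | #|J| <= d]| = \sum_(j < d.+1) 'C(n, j).
Proof.
rewrite -sum1_card (partition_big (fun J : {set 'I_n} => inord #|J| : 'I_d.+1) xpredT) //=.
apply: eq_bigr => j _; rewrite -[n in RHS]card_ord -card_draws -sum1_card.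
apply: eq_bigl => J; rewrite !inE; apply/andP/eqP => [[Jd /eqP <-]|->].
  by rewrite inordK.
by rewrite -ltnS ltn_ord inord_val.
Qed.

Lemma count_shattering (T : finType) n d (F : {set {ffun 'I_n -> T}}) :
    (forall J : {set 'I_n}, #|J| <= d -> exists A : 'I_n -> {set T},
      [/\ forall i, (i \in J) < #|A i| &
          forall p : {ffun 'I_n -> T}, (forall i, p i \in A i) -> p \in F]) ->
  \sum_(j < d.+1) 'C(n, j) <= #|F|.
Proof.
move=> sh; rewrite -card_subsets_le.
pose G (t : n.-tuple T) := [ffun i => tnth t i] \in F.
have ->: #|F| = \sum_t G t.
  rewrite -sum1_card big_mkcond /=.
  rewrite (reindex (fun t : n.-tuple T => [ffun i => tnth t i])) /=.
    by apply: eq_bigr => t _; rewrite /G; case: (_ \in _).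
  exists (fun p : {ffun 'I_n -> T} => [tuple p i | i < n]) => p _.
    by apply: eq_from_tnth => i; rewrite tnth_mktuple ffunE.
  by apply/ffunP => i; rewrite ffunE tnth_mktuple.
apply: leq_trans (card_shattered G).
pose mask (J : {set 'I_n}) := [tuple i \in J | i < n].
have mask_inj : injective mask.
  move=> J J' /(congr1 (@tnth _ _)) e; apply/setP=> i.
  by have := congr1 (fun f => f i) e; rewrite !tnth_mktuple.
rewrite -(card_imset _ mask_inj) -sum1_card big_mkcond /=; apply: leq_sum => m _.
case: ifP => // /imsetP[J]; rewrite inE => /sh[A [cA AF]] ->{m}.
have all2P (S S' : eqType) (t : n.-tuple S) (B : n.-tuple S') r :
    all2 r t B = [forall i, r (tnth t i) (tnth B i)].
  rewrite all2E !size_tuple eqxx /=; apply/allP/forallP => [H i|H].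
    have := H (tnth t i, tnth B i); apply.
    apply/(nthP (tnth t i, tnth B i)); exists i.
      by rewrite size_zip !size_tuple minnn.
    by rewrite nth_zip ?size_tuple // -!tnth_nth.
  case=> s s' /(nthP (s, s'))[i]; rewrite size_zip !size_tuple minnn => il.
  rewrite nth_zip ?size_tuple // => -[<- <-] /=.
  by have := H (Ordinal il); rewrite (tnth_nth s) (tnth_nth s').
rewrite lt0b; apply/existsP; exists [tuple A i | i < n]; rewrite all2P.
apply/andP; split; first by apply/forallP => i; rewrite !tnth_mktuple cA.
apply/forallP=> t; rewrite all2P; apply/implyP=> /forallP tA.
by apply: AF => i; rewrite ffunE; have := tA i; rewrite tnth_mktuple.
Qed.

Local Open Scope ring_scope.

(** * Attainment in linear programming *)

Section LinearProgramming.
Variable R : realFieldType.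

Definition dotv d (a x : 'rV[R]_d) : R := \sum_i a 0 i * x 0 i.

Lemma dotvDr d (a x y : 'rV[R]_d) : dotv a (x + y) = dotv a x + dotv a y.
Proof. by rewrite -big_split; apply: eq_bigr => i _; rewrite mxE mulrDr. Qed.

Lemma dotvZr d (a x : 'rV[R]_d) t : dotv a (t *: x) = t * dotv a x.
Proof. by rewrite mulr_sumr; apply: eq_bigr => i _; rewrite mxE mulrCA. Qed.

Lemma dotvNr d (a x : 'rV[R]_d) : dotv a (- x) = - dotv a x.
Proof. by rewrite -scaleN1r dotvZr mulN1r. Qed.

Lemma dotvBr d (a x y : 'rV[R]_d) : dotv a (x - y) = dotv a x - dotv a y.
Proof. by rewrite dotvDr dotvNr. Qed.

Lemma dotv0r d (a : 'rV[R]_d) : dotv a 0 = 0.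
Proof. by rewrite -(scale0r 0) dotvZr mul0r. Qed.

Lemma dotv_sumr d (a : 'rV[R]_d) (I : Type) (r : seq I) (P : pred I) F :
  dotv a (\sum_(i <- r | P i) F i) = \sum_(i <- r | P i) dotv a (F i).
Proof.
apply: (big_morph (dotv a)); [exact: dotvDr | exact: dotv0r].
Qed.

Lemma dotvDl d (a b x : 'rV[R]_d) : dotv (a + b) x = dotv a x + dotv b x.
Proof. by rewrite -big_split; apply: eq_bigr => i _; rewrite mxE mulrDl. Qed.

Lemma dotvNl d (a x : 'rV[R]_d) : dotv (- a) x = - dotv a x.
Proof. by rewrite -sumrN; apply: eq_bigr => i _; rewrite mxE mulNr. Qed.

Lemma dotvBl d (a b x : 'rV[R]_d) : dotv (a - b) x = dotv a x - dotv b x.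
Proof. by rewrite dotvDl dotvNl. Qed.

Lemma dotv0l d (x : 'rV[R]_d) : dotv 0 x = 0.
Proof. by rewrite /dotv big1 // => i _; rewrite mxE mul0r. Qed.

(** Passes from the members of a finite family of sets to their union: the sets of basic points with
    a given tight set, and later the polyhedra that make up a polyhedral complex. *)
Lemma fin_min (T : Type) (I : finType) (P : I -> T -> Prop) (f : T -> R) :
  (forall i, (exists x, P i x) ->
     exists x, P i x /\ forall y, P i y -> f x <= f y) ->
  (exists i x, P i x) ->
  exists i x, P i x /\ forall j y, P j y -> f x <= f y.
Proof.
move=> H [i0 [x0 Px0]].
have /fin_all_exists[g Pg] i : exists x, (exists z, P i z) ->
    P i x /\ forall y, P i y -> f x <= f y.
  have [/H[x Hx]|nP] := pselect (exists z, P i z); first by exists x.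
  by exists x0.
case: (@arg_minP _ _ _ i0 (fun i => `[< exists z, P i z >]) (f \o g)) => [|i /asboolP/Pg[Pi _] mi].
  by apply/asboolP; exists x0.
exists i, (g i); split=> // j y Pj; have [Pgj gj] := Pg j (ex_intro _ _ Pj).
by apply: le_trans (gj _ Pj); apply: mi; apply/asboolP; exists y.
Qed.

Lemma fin_small_pos (I : finType) (a b : I -> R) :
  exists2 t, 0 < t & forall j, 0 < a j -> 0 < a j + t * b j.
Proof.
(* The sum dominates each ratio, so [t = 1 / (1 + s)] keeps [t * |b j|] below every positive [a j]
   at once. *)
pose s := \sum_(j | 0 < a j) `|b j| / a j.
have s0 : 0 <= s by apply: sumr_ge0 => j aj; rewrite divr_ge0 // ltW.
exists (1 + s)^-1 => [|j aj]; first by rewrite invr_gt0; lra.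
have sj : `|b j| / a j <= s.
  rewrite /s (bigD1 j) //= lerDl; apply: sumr_ge0 => i /andP[ai _].
  by rewrite divr_ge0 // ltW.
have : `|b j| < a j * (1 + s).
  by rewrite -ltr_pdivrMl // mulrC; lra.
rewrite -ltr_pdivrMr; last by lra.
have : - (`|b j| / (1 + s)) <= (1 + s)^-1 * b j.
  rewrite [leRHS]mulrC -mulNr ler_wpM2r ?invr_ge0 //; first lra.
  by rewrite lerNl -normrN ler_norm.
by lra.
Qed.

Section LP.
Variables (d : nat) (C : finType) (al : C -> 'rV[R]_d) (be : C -> R).
Variable l : 'rV[R]_d.
Let g c x := dotv (al c) x + be c.
Let feasible x := forall c, 0 <= g c x.
Let tight x := [set c | g c x == 0].
(** Weaker than being a vertex: only the objective has to be constant along the face of [x], so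
    polyhedra that contain lines cause no trouble. *)
Let basic x :=
  forall v, (forall c, c \in tight x -> dotv (al c) v = 0) -> dotv l v = 0.

Let gD c x t v : g c (x + t *: v) = g c x + t * dotv (al c) v.
Proof. by rewrite /g dotvDr dotvZr addrAC. Qed.

(** Induction on the number of constraints that are not tight. At a point that is not basic, some
    direction keeps the tight constraints and decreases the objective; following it until a new
    constraint becomes tight leaves fewer slack ones. *)
Lemma lp_to_basic m : (forall x, feasible x -> m <= dotv l x) ->
  forall x, feasible x ->
  exists x', [/\ feasible x', basic x' & dotv l x' <= dotv l x].
Proof.
move=> bd x; move: {2}#|~: tight x|.+1 (ltnSn #|~: tight x|) => N.
elim: N x => // N IH x xN fx.
have [bx|nbx] := pselect (basic x); first by exists x.
have [v [tv lv]] : exists v, (forall c, c \in tight x -> dotv (al c) v = 0) /\ dotv l v < 0.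
  move/existsNP: nbx => [v /not_implyP[tv /eqP]].
  rewrite neq_lt => /orP[lv|lv]; first by exists v.
  exists (- v); rewrite dotvNr oppr_lt0; split=> // c ct.
  by rewrite dotvNr tv ?oppr0.
have [c0 vc0] : exists c, dotv (al c) v < 0.
  apply: contrapT => /forallNP nv.
  have {nv} nv c : 0 <= dotv (al c) v by rewrite leNgt; apply/negP/nv.
  (* If no constraint blocked the direction, this step would bring the objective down to [m - 1]. *)
  pose t := (dotv l x - m + 1) / (- dotv l v).
  have t0 : 0 <= t by apply: divr_ge0; have := bd _ fx; lra.
  have /bd : feasible (x + t *: v) by move=> c; rewrite gD addr_ge0 // mulr_ge0.
  rewrite dotvDr dotvZr.
  have -> : t * dotv l v = - (dotv l x - m + 1).
    by rewrite /t invrN mulrN mulNr divfK // lt_eqF.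
  by lra.
(* Ratio test: [q c] is the step length at which the constraint [c] becomes tight. *)
pose q c := g c x / (- dotv (al c) v).
case: (@arg_minP _ _ _ c0 (fun c => dotv (al c) v < 0) q vc0) => c1 vc1 mc1.
have q0 : 0 <= q c1 by apply: divr_ge0 => //; lra.
pose x' := x + q c1 *: v.
have fx' : feasible x'.
  move=> c; rewrite gD; have [vc|vc] := ltP (dotv (al c) v) 0; last first.
    by rewrite addr_ge0 // mulr_ge0.
  have := mc1 c vc; rewrite {2}/q ler_pdivlMr; last lra.
  by lra.
have [|y [fy by_ ly]] := IH x' _ fx'; last first.
  exists y; split => //; apply: le_trans ly _.
  by rewrite /x' dotvDr dotvZr gerDl mulr_ge0_le0 // ltW.
rewrite ltnS in xN; apply: leq_trans xN; apply: proper_card.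
rewrite properC; apply/properP; split.
  apply/fintype.subsetP => c ct; rewrite inE gD tv // mulr0 addr0.
  by move: ct; rewrite inE.
exists c1; first by rewrite inE gD /q; apply/eqP; field; rewrite lt_eqF.
by apply/negP => c1t; move: vc1; rewrite tv ?ltxx.
Qed.

(** Two basic points with the same tight set have the same objective value, so only finitely many
    values compete. *)
Lemma lp_attained : (exists x, feasible x) ->
  (exists m, forall x, feasible x -> m <= dotv l x) ->
  exists x, feasible x /\ forall y, feasible y -> dotv l x <= dotv l y.
Proof.
move=> [x0 fx0] [m bd].
pose P (s : {set C}) x := [/\ feasible x, basic x & tight x = s].
have [s [x [[fx bx _] minx]]] : exists s x, P s x /\
    forall s' y, P s' y -> dotv l x <= dotv l y.
  apply: fin_min; last first.
    by have [x [fx bx _]] := lp_to_basic bd fx0; exists (tight x), x.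
  move=> s [x [fx bx xs]]; exists x; split=> // y [fy by_ ys].
  rewrite le_eqVlt -subr_eq0 -dotvBr bx ?eqxx // => c ct.
  have: c \in tight y by rewrite ys -xs.
  move: ct; rewrite !inE dotvBr /g => /eqP gx /eqP gy; lra.
exists x; split=> // y fy; have [y' [fy' by_ le]] := lp_to_basic bd fy.
by apply: le_trans le; apply: (minx (tight y')).
Qed.

End LP.
End LinearProgramming.

(** * Arrangements of maxout units *)

(* Columns [c < d] of [U i k] are the weights of piece [k] of unit [i], column [d] its
   bias; the case [s = d.+1] thus says that no point carries more than [d] ties. *)
Definition generic (R : realFieldType) n K d (U : 'I_n -> 'I_K -> nat -> R) :=
  forall s (k0 : {ffun 'I_n -> 'I_K}) (e : {ffun 'I_s -> 'I_n * 'I_K}),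
  (s <= d.+1)%N -> injective e -> (forall r, (e r).2 != k0 (e r).1) ->
  \det (\matrix_(r < s, c < s)
          (U (e r).1 (e r).2 c - U (e r).1 (k0 (e r).1) c)) != 0.

Section Arrangement.
Variables (R : realFieldType) (n K d : nat) (U : 'I_n -> 'I_K -> nat -> R).

Definition piece_lin i k : 'rV[R]_d := \row_c U i k c.
Definition piece i k (x : 'rV[R]_d) := dotv (piece_lin i k) x + U i k d.
Lemma pieceE i k x : piece i k x = dotv (piece_lin i k) x + U i k d.
Proof. by []. Qed.

Definition active i k x := [forall k', piece i k' x <= piece i k x].
Definition tied i x :=
  [exists k, exists k', [&& k != k', active i k x & active i k' x]].

Notation lin i k := (dotv (piece_lin i k)).

Lemma pieceD i k x t v : piece i k (x + t *: v) = piece i k x + t * lin i k v.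
Proof. by rewrite /piece dotvDr dotvZr addrAC. Qed.

Lemma activeP i k x : reflect (forall k', piece i k' x <= piece i k x) (active i k x).
Proof. exact: forallP. Qed.

Lemma active_eq i k k' x : active i k x -> active i k' x -> piece i k x = piece i k' x.
Proof.
by move=> /activeP a /activeP a'; apply/eqP; rewrite eq_le a a'.
Qed.

Lemma eq_active i k k' x : active i k x -> piece i k x = piece i k' x -> active i k' x.
Proof. by move=> /activeP a e; apply/activeP => k2; rewrite -e. Qed.

Lemma active_exists (i : 'I_n) (k0 : 'I_K) x : exists k, active i k x.
Proof.
case: (@arg_maxP _ _ _ k0 xpredT (fun k => piece i k x)) => // k _ kM.
by exists k; apply/activeP => k'; apply: kM.
Qed.

Lemma piece_small_move x v : exists2 t, 0 < t & forall i k k',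
  piece i k' x < piece i k x -> piece i k' (x + t *: v) < piece i k (x + t *: v).
Proof.
have [t t0 tP] := fin_small_pos
  (fun z : 'I_n * ('I_K * 'I_K) => piece z.1 z.2.1 x - piece z.1 z.2.2 x)
  (fun z => lin z.1 z.2.1 v - lin z.1 z.2.2 v).
exists t => // i k k' lt; have := tP (i, (k, k')); rewrite !pieceD /=; lra.
Qed.

(** * Linear algebra from genericity *)

Section Generic.
Hypothesis gen : generic d U.

(** The square matrix on the first [#|S|] columns is invertible; its solution is padded with zeros
    in the remaining coordinates. *)
Lemma generic_solve (k0 : 'I_n -> 'I_K) (S : {set 'I_n * 'I_K}) :
  (forall z, z \in S -> z.2 != k0 z.1) -> (#|S| <= d)%N ->
  forall y : 'I_n * 'I_K -> R, exists v, forall z, z \in S ->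
    lin z.1 z.2 v - lin z.1 (k0 z.1) v = y z.
Proof.
move=> Sk0 Sd y; pose s := #|S|.
pose e : {ffun 'I_s -> 'I_n * 'I_K} := [ffun r => enum_val r].
have := @gen s (finfun k0) e (leqW Sd).
set M := (\matrix_(r, c) _) => detM.
have {detM} uM : M \in unitmx.
  rewrite unitmxE unitfE; apply: detM => [r r'|r].
    by rewrite !ffunE => /enum_val_inj.
  by rewrite !ffunE Sk0 // enum_valP.
have [z zP] : exists z, M *m z = \col_r y (e r).
  by exists (invmx M *m \col_r y (e r)); rewrite mulKVmx.
pose zz (c : nat) : R := if insub c is Some j then z (j : 'I_s) 0 else 0.
exists (\row_(c < d) zz c) => w wS.
have := congr1 (fun A : 'cV_s => A (enum_rank_in wS w) 0) zP.
rewrite !mxE ffunE enum_rankK_in // => <-.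
rewrite -dotvBl /dotv.
pose G (c : nat) := (U w.1 w.2 c - U w.1 (k0 w.1) c) * zz c.
transitivity (\sum_(c < d) G c); first by apply: eq_bigr => c _; rewrite !mxE.
transitivity (\sum_(c < s) G c).
  rewrite (big_ord_widen _ G Sd) [RHS]big_mkcond; apply: eq_bigr => c _.
  by case: ifP => // cs; rewrite /G /zz insubF ?mulr0.
apply: eq_bigr => c _; rewrite !mxE !ffunE enum_rankK_in //.
rewrite /G /zz insubT //= => cs; congr (_ * z _ _); exact: val_inj.
Qed.

Definition ties (k0 : 'I_n -> 'I_K) x :=
  [set z : 'I_n * 'I_K | active z.1 z.2 x && (z.2 != k0 z.1)].

(** With [d.+1] ties the vector [x] extended by a final 1 would be a nonzero kernel vector of an
    invertible matrix. *)
Lemma card_ties k0 x : (forall i, active i (k0 i) x) -> (#|ties k0 x| <= d)%N.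
Proof.
move=> k0x; rewrite leqNgt; apply/negP => Sd.
pose e : {ffun 'I_d.+1 -> 'I_n * 'I_K} :=
  [ffun r => enum_val (widen_ord Sd r)].
have eS r : e r \in ties k0 x by rewrite ffunE enum_valP.
have := @gen d.+1 (finfun k0) e (leqnn _).
set M := (\matrix_(r, c) _) => detM.
have {detM} uM : M \in unitmx.
  rewrite unitmxE unitfE; apply: detM => [r r'|r].
    by rewrite !ffunE => /enum_val_inj[e']; apply: ord_inj.
  by rewrite [X in _ != X]ffunE; have := eS r; rewrite inE => /andP[].
pose X : 'cV[R]_d.+1 := \col_c (if insub (c : nat) is Some j then x 0 (j : 'I_d) else 1).
have MX : M *m X = 0.
  apply/colP => r; rewrite !mxE big_ord_recr /=.
  have := eS r; rewrite inE => /andP[ar _].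
  have := active_eq ar (k0x (e r).1); rewrite /piece => e0.
  rewrite !mxE insubF ?ltnn // mulr1 [(finfun k0) _]ffunE.
  transitivity (lin (e r).1 (e r).2 x - lin (e r).1 (k0 (e r).1) x
      + (U (e r).1 (e r).2 d - U (e r).1 (k0 (e r).1) d)); last lra.
  rewrite -dotvBl /dotv; congr (_ + _); apply: eq_bigr => c _.
  rewrite !mxE [(finfun k0) _]ffunE insubT //= => cd; congr (_ * x _ _); exact: val_inj.
have := congr1 (fun A : 'cV_d.+1 => A ord_max 0) (mulKmx uM X).
rewrite MX mulmx0 !mxE insubF ?ltnn // => /esym/eqP.
by rewrite oner_eq0.
Qed.

(** With [d] ties the weight differences form an invertible square matrix, so [x] is a vertex: no
    direction preserves all its ties. *)
Lemma ties_inj k0 x v : (forall i, active i (k0 i) x) -> #|ties k0 x| = d ->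
  (forall i k, active i k x -> lin i k v = lin i (k0 i) v) -> v = 0.
Proof.
move=> k0x Sd vz; pose S := ties k0 x.
pose e : {ffun 'I_d -> 'I_n * 'I_K} := [ffun r => enum_val (cast_ord (esym Sd) r)].
have eS r : e r \in S by rewrite ffunE enum_valP.
have := @gen d (finfun k0) e (leqnSn _).
set M := (\matrix_(r, c) _) => detM.
have {detM} uM : M \in unitmx.
  rewrite unitmxE unitfE; apply: detM => [r r'|r].
    by rewrite !ffunE => /enum_val_inj/cast_ord_inj.
  by rewrite [X in _ != X]ffunE; have := eS r; rewrite inE => /andP[].
have Mv : M *m v^T = 0.
  apply/colP => r; rewrite !mxE.
  have := eS r; rewrite inE => /andP[ar _].
  transitivity (lin (e r).1 (e r).2 v - lin (e r).1 (k0 (e r).1) v); last first.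
    by rewrite vz ?subrr.
  by rewrite -dotvBl /dotv; apply: eq_bigr => c _; rewrite !mxE [(finfun k0) _]ffunE.
by apply: trmx_inj; rewrite -(mulKmx uM v^T) Mv mulmx0 trmx0.
Qed.

(** By [card_ties] the ties at one point are few enough for [generic_solve], so the rates of change
    of the active pieces can be prescribed up to one constant per unit. *)
Lemma solve_at k0 x : (forall i, active i (k0 i) x) ->
  forall y : 'I_n -> 'I_K -> R, exists v, forall i k, active i k x ->
    lin i k v - lin i (k0 i) v = y i k - y i (k0 i).
Proof.
move=> k0x y.
have [z|v vP] := @generic_solve k0 (ties k0 x) _ (card_ties k0x)
    (fun z => y z.1 z.2 - y z.1 (k0 z.1)).
  by rewrite inE => /andP[].
exists v => i k ak; have [->|kk0] := eqVneq k (k0 i); first by rewrite !subrr.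
by apply: (vP (i, k)); rewrite inE ak.
Qed.

(** A direction that raises each [p i] above its tied rivals makes it strictly maximal after a short
    move. *)
Lemma open_cell x (p : 'I_n -> 'I_K) : (forall i, active i (p i) x) ->
  exists x', forall i k, k != p i -> piece i k x' < piece i (p i) x'.
Proof.
move=> px; have [v vP] := solve_at px (fun i k => if k == p i then 1 else 0).
have [t t0 tP] := piece_small_move x v.
exists (x + t *: v) => i k kp.
have := activeP _ _ _ (px i) k; rewrite le_eqVlt => /orP[/eqP e|]; last exact: tP.
have ak : active i k x by apply: (eq_active (px i)); rewrite e.
rewrite !pieceD e ltrD2l ltr_pM2l //.
have := vP _ _ ak; rewrite eqxx (negPf kp); lra.
Qed.

(* [E z] raises the piece [z] relative to all other pieces active at [x]. *)
Lemma raise_at k0 x : (forall i, active i (k0 i) x) ->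
  exists E : 'I_n * 'I_K -> 'rV[R]_d, forall z i k, active i k x ->
    lin i k (E z) - lin i (k0 i) (E z) = ((i, k) == z)%:R - ((i, k0 i) == z)%:R.
Proof.
move=> k0x.
have /fin_all_exists[E EP] (z : 'I_n * 'I_K) := solve_at k0x (fun i k => ((i, k) == z)%:R).
by exists E.
Qed.

(* If no direction fixing all ties in [J] changes the difference [l] of the pieces [p]
   and [k], then [l] depends on some unit with at least three active pieces; lowering
   one of these decreases [l] and keeps the unit tied. *)
Lemma descent_direction (J : {set 'I_n}) m x (p k : 'I_K) :
  m \notin J -> (#|J| < d)%N -> (forall i, i \in J -> tied i x) -> p != k ->
  exists v, lin m p v - lin m k v < 0 /\ forall i, i \in J ->
    exists a b, [/\ a != b, active i a x, active i b x, lin i a v = lin i b v &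
      forall k', active i k' x -> lin i k' v <= lin i a v].
Proof.
move=> mJ Jd tJ pk.
pose l v := lin m p v - lin m k v.
have lZ t v : l (t *: v) = t * l v by rewrite /l !dotvZr mulrBr.
have lE v : l v = dotv (piece_lin m p - piece_lin m k) v by rewrite dotvBl.
have /fin_all_exists[k0 k0x] : forall i : 'I_n, exists k0, active i k0 x.
  by move=> i; exact: active_exists i k x.
have /fin_all_exists[k1 k1P] : forall i : 'I_n, exists k1, i \in J ->
    k1 != k0 i /\ active i k1 x.
  move=> i; have [/tJ/existsP[a /existsP[b /and3P[ab aa ba]]]|] := boolP (i \in J); last by exists p.
  by have [e|ne] := eqVneq a (k0 i); [exists b; rewrite -e eq_sym|exists a].
pose flat v := forall i k', i \in J -> active i k' x -> lin i k' v = lin i (k0 i) v.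
have [[v [fv lv]]|nv] := pselect (exists v, flat v /\ l v <> 0).
  have [w [fw lw]] : exists w, flat w /\ l w < 0.
    have [lv0|lv0] := ltP (l v) 0; first by exists v.
    exists (- v); split=> [i k' iJ ak'|]; first by rewrite !dotvNr fv.
    by rewrite -scaleN1r lZ mulN1r oppr_lt0 lt_neqAle lv0 andbT eq_sym; apply/eqP.
  exists w; split=> // i iJ; have [k10 ak1] := k1P i iJ.
  exists (k0 i), (k1 i); rewrite eq_sym fw // k10 ak1 k0x; split=> // k' ak'.
  by rewrite fw.
have {nv} l0 v : flat v -> l v = 0.
  by move=> fv; apply: contrapT => lv; apply: nv; exists v.
(* One equation for [l] and one per unit of [J]: at most [d], since [J] has fewer than [d] units.
   The solution keeps [k0 i] and [k1 i] tied but may separate further active pieces. *)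
pose S := (m, p) |: [set (i, k1 i) | i in J].
pose k0' i := if i == m then k else k0 i.
have Sk0' z : z \in S -> z.2 != k0' z.1.
  rewrite in_setU1 => /orP[/eqP ->|/imsetP[i iJ ->]]; rewrite /k0' /=.
    by rewrite eqxx.
  by have [e|_] := eqVneq i m; [rewrite -e iJ in mJ | case: (k1P i iJ)].
have Sd : (#|S| <= d)%N.
  apply: leq_trans Jd; rewrite /S cardsU1 -add1n; apply: leq_add.
    by case: (_ \notin _).
  exact: leq_imset_card.
have [v vP] := generic_solve Sk0' Sd (fun z => if z == (m, p) then 1 else 0).
have lv1 : l v = 1.
  by have := vP (m, p); rewrite /k0' /= !eqxx; apply; rewrite setU11.
have v1 i : i \in J -> lin i (k1 i) v = lin i (k0 i) v.
  move=> iJ; have im : i != m by apply: contraNneq mJ => <-.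
  have := vP (i, k1 i); rewrite /k0' /= (negPf im) xpair_eqE (negPf im) /=.
  by move=> H; apply/eqP; rewrite -subr_eq0 H // in_setU1 imset_f ?orbT.
have [E EP] := raise_at k0x.
pose A := [set z : 'I_n * 'I_K | (z.1 \in J) && active z.1 z.2 x].
pose y (z : 'I_n * 'I_K) := lin z.1 z.2 v - lin z.1 (k0 z.1) v.
(* Removing the separations that [v] creates leaves a flat direction, on which [l] vanishes; hence
   [l v = 1] is the sum of the terms [y z * l (E z)]. *)
have : l (v - \sum_(z in A) y z *: E z) = 0.
  apply: l0 => i k' iJ ak'; apply/eqP; rewrite -subr_eq0 -dotvBl dotvBr dotv_sumr.
  rewrite subr_eq0; apply/eqP; rewrite dotvBl -/(y (i, k')).
  under eq_bigr => z _ do rewrite dotvZr dotvBl EP // mulrBr.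
  rewrite big_split /= (bigD1 (i, k')) ?inE ?iJ //= eqxx mulr1 big1 ?addr0 => [|z]; last first.
    by rewrite eq_sym => /andP[_ /negPf ->]; rewrite mulr0.
  rewrite big1 ?addr0 // => z zA; case: eqP => [<-|_]; last by rewrite mulr0 oppr0.
  by rewrite /y subrr mul0r oppr0.
have lB a b : l (a - b) = l a - l b by rewrite !lE dotvBr.
have lsum (P : pred ('I_n * 'I_K)) F : l (\sum_(z | P z) F z) = \sum_(z | P z) l (F z).
  by rewrite lE dotv_sumr; apply: eq_bigr => z _; rewrite lE.
rewrite lB lsum lv1 => /eqP; rewrite subr_eq0 => /eqP s1.
have [[i k2] zA yl] : exists2 z, z \in A & y z * l (E z) != 0.
  apply: contrapT => nz; move: s1; rewrite big1 => [/eqP|z zA]; first by rewrite oner_eq0.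
  by rewrite lZ; apply/eqP/negPn/negP => h; apply: nz; exists z.
move: zA; rewrite inE /= => /andP[iJ ak2].
have [k10 ak1] := k1P i iJ.
move: yl; rewrite mulf_eq0 negb_or => /andP[y2 c2].
have k20 : k2 != k0 i by apply: contraNneq y2 => ->; rewrite /y subrr.
have k21 : k2 != k1 i by apply: contraNneq y2 => ->; rewrite /y /= v1 // subrr.
(* Raising all active pieces of unit [i] together is flat. The values [l (E (i, k'))] therefore sum
   to 0, and as the one for [k2] is nonzero, some other or the same one is positive. *)
have s0 : \sum_(k' | active i k' x) l (E (i, k')) = 0.
  transitivity (l (\sum_(k' | active i k' x) E (i, k'))).
    by rewrite lE dotv_sumr; apply: eq_bigr => z _; rewrite lE.
  apply: l0 => j k' jJ ak'; apply/eqP; rewrite -subr_eq0 -dotvBl dotv_sumr.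
  under eq_bigr => z _ do rewrite dotvBl EP // !xpair_eqE.
  have [ji|ji] := eqVneq j i; last by rewrite big1 // => z _; rewrite !subrr.
  subst j; rewrite big_split /= (bigD1 k') //= eqxx big1 ?addr0 => [|z]; last first.
    by rewrite eq_sym => /andP[_ /negPf ->].
  rewrite (bigD1 (k0 i)) //= eqxx big1 ?addr0 ?subrr // => z.
  by rewrite eq_sym => /andP[_ /negPf ->]; rewrite oppr0.
have [k3 ak3 c3] : exists2 k3, active i k3 x & 0 < l (E (i, k3)).
  apply: contrapT => n3.
  have le0 k' : active i k' x -> l (E (i, k')) <= 0.
    by move=> ak'; rewrite leNgt; apply/negP => h; apply: n3; exists k'.
  move: s0; rewrite (bigD1 k2) //=.
  have : \sum_(k' | active i k' x && (k' != k2)) l (E (i, k')) <= 0.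
    by apply: sumr_le0 => k' /andP[/le0].
  have := le0 _ ak2; rewrite le_eqVlt (negPf c2) /=; lra.
exists (- E (i, k3)); split; first by rewrite !dotvNr -/(l _); move: c3; rewrite /l; lra.
have diff j k' : active j k' x -> lin j k' (E (i, k3)) =
    lin j (k0 j) (E (i, k3)) + ((j, k') == (i, k3))%:R - ((j, k0 j) == (i, k3))%:R.
  by move=> ak'; have := EP (i, k3) j k' ak'; lra.
move=> j jJ; have [k10' ak1'] := k1P j jJ.
suff [a [b [ab aa ba a3 b3]]] : exists a b, [/\ a != b, active j a x, active j b x,
    (j, a) != (i, k3) & (j, b) != (i, k3)].
  exists a, b; split=> //.
    by rewrite !dotvNr (diff j a) // (diff j b) // (negPf a3) (negPf b3).
  move=> k' ak'; rewrite !dotvNr lerN2 (diff j a) // (diff j k') // (negPf a3).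
  by rewrite lerD2r lerD2l; case: eqP.
(* Unit [i] has the three active pieces [k0 i], [k1 i], [k2], so two of them remain after [k3] is
   lowered. *)
have [ji|ji] := eqVneq j i; last first.
  by exists (k0 j), (k1 j); rewrite eq_sym k10' k0x ak1' !xpair_eqE (negPf ji).
subst j.
have [e|ne] := eqVneq k3 (k0 i).
  by exists (k1 i), k2; split=> //; rewrite ?xpair_eqE ?eqxx ?e //= 1?eq_sym.
have [e|ne1] := eqVneq k3 (k1 i).
  by exists (k0 i), k2; split=> //; rewrite ?xpair_eqE ?eqxx ?e //= 1?eq_sym.
by exists (k0 i), (k1 i); split=> //; rewrite ?xpair_eqE ?eqxx //= 1?eq_sym.
Qed.

End Generic.
End Arrangement.

(** * Existence and counting of cells *)

Section Cells.
Variables (R : realFieldType) (n K d : nat) (U : 'I_n -> 'I_K -> nat -> R).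
Hypotheses (gen : generic d U) (K2 : (2 <= K)%N).
Notation lin i k := (dotv (piece_lin d U i k)).
Notation piece := (@piece R n K d U).
Notation active := (@active R n K d U).
Notation tied := (@tied R n K d U).

Lemma other_piece (p : 'I_K) : exists k, p != k.
Proof.
have : (0 < #|[set~ p]|)%N by rewrite cardsC1 card_ord -ltnS prednK // ltnW.
by case/card_gt0P => k; rewrite !inE eq_sym; exists k.
Qed.

Lemma tied_exists (J : {set 'I_n}) : (#|J| <= d)%N ->
  exists x : 'rV[R]_d, forall i, i \in J -> tied i x.
Proof.
have [N] := ubnP #|J|; elim: N J => // N IH J JN Jd.
have [->|/set0Pn[m mJ]] := eqVneq J finset.set0; first by exists 0 => i; rewrite inE.
pose J' := J :\ m; have J'm : m \notin J' by rewrite !inE eqxx.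
have cJ : #|J| = #|J'|.+1 by rewrite (cardsD1 m J) mJ.
rewrite cJ in JN Jd.
have [x0 x0t] := IH J' JN (ltnW Jd).
apply: contrapT => /forallNP nt.
have {nt} nt (x : 'rV[R]_d) : (forall i, i \in J' -> tied i x) -> ~ tied m x.
  move=> tx mx; apply: (nt x) => i iJ; have [->//|im] := eqVneq i m.
  by apply: tx; rewrite !inE im.
have [p px0] : exists p, active m p x0 by apply: (@active_exists _ _ _ _ U m (Ordinal (ltnW K2))).
have [k pk] := other_piece p.
pose T x := (forall i, i \in J' -> tied i x) /\ active m p x.
(* Prescribing which two pieces tie in each unit of [J'] splits [T] into finitely many polyhedra. *)
pose P (s : {ffun 'I_n -> 'I_K * 'I_K}) (x : 'rV[R]_d) := (forall i, i \in J' ->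
  [/\ (s i).1 != (s i).2, active i (s i).1 x & active i (s i).2 x]) /\ active m p x.
have TP x : T x <-> exists s, P s x.
  split=> [[tx mx]|[s [sx mx]]]; last first.
    split=> // i /sx [ne a1 a2]; apply/existsP; exists (s i).1.
    by apply/existsP; exists (s i).2; rewrite ne a1.
  have /fin_all_exists[s sP] i : exists s : 'I_K * 'I_K, i \in J' ->
      [/\ s.1 != s.2, active i s.1 x & active i s.2 x].
    case: (boolP (i \in J')) => [/tx/existsP[a /existsP[b /and3P[]]]|_].
      by exists (a, b).
    by exists (k, k).
  by exists (finfun s); split=> // i; rewrite ffunE; apply: sP.
have [s [x [Psx minx]]] : exists s x, P s x /\ forall s' y, P s' y ->
    dotv (piece_lin d U m p - piece_lin d U m k) x <=
    dotv (piece_lin d U m p - piece_lin d U m k) y.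
  apply: fin_min; last by have /TP[s Ps] : T x0 by []; exists s, x0.
  move=> s [x [sx mx]].
  (* The constraint [(i, k', b)] puts the first or second piece of [s i], according to [b], above
     piece [k']; for [m] the dominating piece is [p], and all other units get the trivial
     constraint. *)
  pose al (c : 'I_n * 'I_K * bool) := if c.1.1 \in J' then
      piece_lin d U c.1.1 (if c.2 then (s c.1.1).1 else (s c.1.1).2) - piece_lin d U c.1.1 c.1.2
    else if c.1.1 == m then piece_lin d U m p - piece_lin d U m c.1.2 else 0.
  pose be (c : 'I_n * 'I_K * bool) := if c.1.1 \in J' then
      U c.1.1 (if c.2 then (s c.1.1).1 else (s c.1.1).2) d - U c.1.1 c.1.2 d
    else if c.1.1 == m then U m p d - U m c.1.2 d else 0.
  have feasP y : (forall c, 0 <= dotv (al c) y + be c) <-> P s y.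
    split=> [fy|[sy my] [[i k'] b]]; last first.
      rewrite /al /be /=; case: ifP => [/sy[_ a1 a2]|_].
        by rewrite dotvBl; case: b; [move/activeP: a1 => /(_ k')|move/activeP: a2 => /(_ k')];
           rewrite !pieceE; lra.
      case: eqP => _; last by rewrite dotv0l addr0.
      by move/activeP: my => /(_ k'); rewrite dotvBl !pieceE; lra.
    split=> [i iJ|].
      have [ne _ _] := sx i iJ; split=> //; apply/activeP => k'.
        by have := fy (i, k', true); rewrite /al /be /= iJ dotvBl !pieceE; lra.
      by have := fy (i, k', false); rewrite /al /be /= iJ dotvBl !pieceE; lra.
    apply/activeP => k'; have := fy (m, k', true).
    by rewrite /al /be /= (negPf J'm) eqxx dotvBl !pieceE; lra.
  have [||y [/feasP fy my]] :=
      @lp_attained R d _ al be (piece_lin d U m p - piece_lin d U m k).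
  - by exists x; apply/feasP.
  (* Since [p] is maximal for [m] on the polyhedron, its difference with [k] is nonnegative, and the
     biases bound the linear part. *)
  - exists (U m k d - U m p d) => y /feasP[_ /activeP/(_ k)].
    by rewrite dotvBl !pieceE; lra.
  by exists y; split=> // z /feasP; apply: my.
have [tx mx] : T x by apply/TP; exists s.
(* As [m] is tied nowhere on [T], its active piece is strictly maximal and survives a short move; so
   a descent direction stays in [T] and contradicts minimality. *)
have strict k' : k' != p -> piece m k' x < piece m p x.
  move=> kp; have /activeP/(_ k') := mx; rewrite le_eqVlt => /orP[/eqP e|//].
  case: (nt x tx); apply/existsP; exists k'; apply/existsP; exists p.
  by rewrite kp mx (eq_active mx).
have [v [lv vP]] := descent_direction gen J'm Jd tx pk.
have [t t0 tP] := piece_small_move U x v.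
have /TP[s' /minx] : T (x + t *: v).
  split; last first.
    apply/activeP => k'; have [->//|kp] := eqVneq k' p.
    by apply/ltW/tP/strict.
  move=> i /vP[a [b [ab aa ba e le]]].
  have aa' : active i a (x + t *: v).
    apply/activeP => k'; have /activeP/(_ k') := aa.
    rewrite le_eqVlt => /orP[/eqP e'|]; last by move/tP/ltW.
    by rewrite !pieceD e' lerD2l ler_pM2l // le // (eq_active aa).
  apply/existsP; exists a; apply/existsP; exists b; rewrite ab aa' /=.
  by apply: (eq_active aa'); rewrite !pieceD e (active_eq aa ba).
rewrite dotvDr dotvZr dotvBl; have : t * (lin m p v - lin m k v) < 0.
  by rewrite pmulr_rlt0.
by rewrite -dotvBl; lra.
Qed.

(** Cells are closed: any choice of pieces active at a common point is a nonempty cell at once, and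
    [open_cell] later provides a point of strict maximality. *)
Definition cell (p : {ffun 'I_n -> 'I_K}) (x : 'rV[R]_d) := forall i, active i (p i) x.

Lemma count_cells :
  (\sum_(j < d.+1) 'C(n, j) <= #|[set p | `[< exists x, cell p x >]]|)%N.
Proof.
apply: count_shattering => J /tied_exists[x xJ].
exists (fun i => [set k | active i k x]); split=> [i|p px]; last first.
  by rewrite inE; apply/asboolP; exists x => i; have := px i; rewrite inE.
have [k ak] := active_exists U i (Ordinal (ltnW K2)) x.
case: (boolP (i \in J)) => [/xJ/existsP[a /existsP[b /and3P[ab aa ba]]]|_].
  by apply/card_gt1P; exists a, b; rewrite !inE.
by apply/card_gt0P; exists k; rewrite inE.
Qed.

(* The cell at the vertex [v] is cut out of a simplicial cone on which the
   difference of two pieces of unit [m] is maximal at [v], by the condition that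
   this difference is nonnegative. *)
Lemma bounded_cell (kap : 'I_K -> 'I_K) (m : 'I_n) (J : {set 'I_n}) :
  (forall k, k != kap k) -> m \notin J -> #|J| = d ->
  exists p v, [/\ cell p v, forall i, tied i v = (i \in J),
    exists M, forall x, cell p x -> forall c, `|x 0 c| <= M &
    forall x, cell p x ->
      piece m (p m) x - piece m (kap (p m)) x <= piece m (p m) v - piece m (kap (p m)) v
      ?= iff (x == v)].
Proof.
move=> kapP mJ Jd.
have [v vJ] := tied_exists (eq_leq Jd).
have /fin_all_exists[k0 k0v] : forall i : 'I_n, exists k0, active i k0 v.
  by move=> i; apply: active_exists (Ordinal (ltnW K2)) _.
have /fin_all_exists[k1 k1P] : forall i : 'I_n, exists k1, i \in J ->
    k1 != k0 i /\ active i k1 v.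
  move=> i; have [/vJ/existsP[a /existsP[b /and3P[ab aa ba]]]|] := boolP (i \in J).
    by have [e|ne] := eqVneq a (k0 i); [exists b; rewrite -e eq_sym|exists a].
  by exists (k0 i).
(* These [d] ties reach the maximum allowed by [card_ties], so at [v] the units of [J] have exactly
   two active pieces and all others one. *)
pose S1 := [set (i, k1 i) | i in J].
have S1sub : S1 \subset ties U k0 v.
  by apply/fintype.subsetP => z /imsetP[i /k1P[ne a1] ->]; rewrite inE /= a1.
have S1card : #|S1| = d by rewrite card_imset // => i j [].
have S1E : S1 = ties U k0 v.
  by apply/eqP; rewrite eqEcard S1sub S1card card_ties.
have Sd : #|ties U k0 v| = d by rewrite -S1E.
have actE i k : active i k v -> k = k0 i \/ i \in J /\ k = k1 i.
  move=> ak; have [->|ne] := eqVneq k (k0 i); [by left|right].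
  have : (i, k) \in S1 by rewrite S1E inE ak.
  by case/imsetP => j jJ [-> ->].
have tiedE i : tied i v = (i \in J).
  have [/vJ//|iJ] := boolP (i \in J).
  apply/negbTE/negP => /existsP[a /existsP[b /and3P[ab /actE aE /actE bE]]].
  case: aE bE ab => [->|[aJ]]; last by rewrite aJ in iJ.
  by case=> [->|[bJ]]; [rewrite eqxx | rewrite bJ in iJ].
pose l (x : 'rV[R]_d) := lin m (k0 m) x - lin m (kap (k0 m)) x.
have lE x : l x = dotv (piece_lin d U m (k0 m) - piece_lin d U m (kap (k0 m))) x by rewrite dotvBl.
(* The functions [df i] for [i] in [J] are linear coordinates, dual to the basis [E i] below. *)
pose df i (x : 'rV[R]_d) := lin i (k1 i) x - lin i (k0 i) x.
have dfE i x : df i x = dotv (piece_lin d U i (k1 i) - piece_lin d U i (k0 i)) x by rewrite dotvBl.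
have df_inj x y : (forall i, i \in J -> df i x = df i y) -> x = y.
  move=> xy; apply/eqP; rewrite -subr_eq0; apply/eqP.
  apply: (ties_inj gen k0v Sd) => i k /actE[->//|[iJ ->]].
  by have := xy i iJ; rewrite /df !dotvBr; lra.
have [E0 EP] := raise_at gen k0v.
pose E i := E0 (i, k1 i).
have dfE1 i j : i \in J -> j \in J -> df j (E i) = (j == i)%:R.
  move=> iJ jJ; have [ne' a1] := k1P j jJ; rewrite /df EP // !xpair_eqE.
  have [e|ne] := eqVneq j i; last by rewrite subrr.
  by subst j; rewrite eqxx /= eq_sym (negPf ne') subr0.
have decomp x : x = \sum_(i in J) df i x *: E i.
  apply: df_inj => j jJ; rewrite [RHS]dfE dotv_sumr (bigD1 j) //=.
  rewrite dotvZr -dfE dfE1 // eqxx mulr1 big1 ?addr0 // => i /andP[iJ ij].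
  by rewrite dotvZr -dfE dfE1 // eq_sym (negPf ij) mulr0.
(* Otherwise [l] would depend only on the coordinates other than [df i], whereas genericity yields a
   vector on which these vanish and [l] is 1. *)
have lEi i : i \in J -> l (E i) != 0.
  move=> iJ; pose S := (m, k0 m) |: [set (j, k1 j) | j in J :\ i].
  pose k0' j := if j == m then kap (k0 m) else k0 j.
  have Sk0' z : z \in S -> z.2 != k0' z.1.
    rewrite in_setU1 => /orP[/eqP ->|/imsetP[j]]; rewrite /k0' /=.
      by rewrite eqxx kapP.
    rewrite !inE => /andP[_ jJ] -> /=.
    by have [e|_] := eqVneq j m; [rewrite -e jJ in mJ | case: (k1P j jJ)].
  have cS : (#|S| <= d)%N.
    rewrite -Jd (cardsD1 i) iJ /S cardsU1; apply: leq_add; first by case: (_ \notin _).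
    exact: leq_imset_card.
  have [v' vP] := generic_solve gen Sk0' cS (fun z => if z == (m, k0 m) then 1 else 0).
  have lv1 : l v' = 1.
    by have := vP (m, k0 m); rewrite /k0' /= !eqxx; apply; rewrite setU11.
  apply/negP => /eqP lEi0; move: lv1.
  rewrite lE (decomp v') dotv_sumr big1 => [/esym/eqP|j jJ]; first by rewrite oner_eq0.
  rewrite dotvZr -lE; have [->|ji] := eqVneq j i; first by rewrite lEi0 mulr0.
  have jm : j != m by apply: contraNneq mJ => <-.
  have := vP (j, k1 j); rewrite /k0' /= (negPf jm) -/(df j v') xpair_eqE (negPf jm) /=.
  by move->; rewrite ?mul0r // in_setU1 imset_f ?orbT // !inE ji.
(* The sign of [l (E i)] decides between the two tied pieces so that every term of [l (x - v)] is
   nonpositive on the cell. *)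
pose p := [ffun i => if (i \in J) && (l (E i) < 0) then k1 i else k0 i].
have pm : p m = k0 m by rewrite ffunE (negPf mJ).
have cpv : cell p v.
  by move=> i; rewrite ffunE; case: ifP => // /andP[/k1P[]].
have piece_l x : piece m (p m) x - piece m (kap (p m)) x =
    piece m (p m) v - piece m (kap (p m)) v + l (x - v).
  by rewrite pm !pieceE /l !dotvBr; lra.
have term x i : cell p x -> i \in J -> l (E i) * df i (x - v) <= 0.
  move=> px iJ; have [ne a1] := k1P i iJ.
  have := active_eq a1 (k0v i); have := px i; rewrite ffunE iJ /= => /activeP pi.
  rewrite !pieceE => e; have [l0|l0] := ltP (l (E i)) 0.
    move: pi; rewrite l0 => /(_ (k0 i)); rewrite !pieceE => le.
    by rewrite nmulr_rle0 // /df !dotvBr; lra.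
  move: pi; rewrite ltNge l0 /= => /(_ (k1 i)); rewrite !pieceE => le.
  by rewrite mulr_ge0_le0 // /df !dotvBr; lra.
have lx x : l (x - v) = \sum_(i in J) l (E i) * df i (x - v).
  rewrite lE {1}(decomp (x - v)) dotv_sumr; apply: eq_bigr => i _.
  by rewrite dotvZr -lE mulrC.
(* On the cell [b + l (x - v)] stays nonnegative because [p m] is active; hence no single
   nonpositive term falls below [- b], which bounds each coordinate. *)
pose b := piece m (p m) v - piece m (kap (p m)) v.
have dfb x i : cell p x -> i \in J -> `|df i (x - v)| <= b / `|l (E i)|.
  move=> px iJ; rewrite ler_pdivlMr ?normr_gt0 ?lEi // -normrM mulrC.
  rewrite ler0_norm ?term //.
  have : 0 <= b + l (x - v).
    by rewrite /b -piece_l subr_ge0; have /activeP := px m; apply.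
  rewrite lx (bigD1 i) //=.
  have : \sum_(j in J | j != i) l (E j) * df j (x - v) <= 0.
    by apply: sumr_le0 => j /andP[jJ _]; apply: term.
  by lra.
exists p, v; split=> // [|x px].
  exists (\sum_c `|v 0 c| + \sum_c \sum_(i in J) b / `|l (E i)| * `|E i 0 c|).
  move=> x px c; rewrite -(subrK v x) {1}(decomp (x - v)) mxE summxE addrC.
  apply: le_trans (ler_normD _ _) _; apply: lerD.
    by rewrite (bigD1 c) //= lerDl sumr_ge0.
  have b0 : 0 <= b by rewrite subr_ge0; have /activeP := cpv m; apply.
  rewrite (bigD1 c) //= -[leLHS]addr0; apply: lerD; last first.
    do 2!apply: sumr_ge0 => ? _; by rewrite mulr_ge0 // divr_ge0.
  apply: le_trans (ler_norm_sum _ _ _) _; apply: ler_sum => i iJ.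
  by rewrite mxE normrM ler_wpM2r // dfb.
rewrite piece_l; apply/leifP; case: eqP => [->|/eqP xv].
  by rewrite subrr lE dotv0r addr0.
rewrite gtrDl lx lt_neqAle sumr_le0 ?andbT => [|i iJ]; last exact: term.
apply: contraNneq xv => s0; apply/eqP; apply: df_inj => i iJ.
apply/eqP; rewrite -subr_eq0 dfE (dfE i v) -dotvBr -dfE; move/eqP: s0.
rewrite -oppr_eq0 -sumrN psumr_eq0 => [/allP/(_ i)|j jJ]; last by rewrite oppr_ge0 term.
by rewrite mem_index_enum iJ oppr_eq0 mulf_eq0 (negPf (lEi i iJ)); apply.
Qed.

(** Each set of [d] units other than the first gives a bounded cell. The cell determines its vertex
    as the unique maximizer, and the units tied there recover the set. *)
Lemma count_bounded_cells : (0 < n)%N ->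
  ('C(n.-1, d) <= #|[set p | `[< (exists x, cell p x) /\
     exists M : R, forall x, cell p x -> forall c, (`|x 0%R c| <= M)%R >]]|)%N.
Proof.
move=> n0; pose m := Ordinal n0.
have /fin_all_exists[kap kapP] := other_piece.
pose Js := [set J : {set 'I_n} | J \subset [set~ m] & #|J| == d].
have <- : #|Js| = 'C(n.-1, d) by rewrite cards_draws cardsC1 card_ord.
pose good (J : {set 'I_n}) (p : {ffun 'I_n -> 'I_K}) (v : 'rV[R]_d) :=
  [/\ cell p v, forall i, tied i v = (i \in J),
    exists M, forall x, cell p x -> forall c, `|x 0 c| <= M &
    forall x, cell p x ->
      piece m (p m) x - piece m (kap (p m)) x <= piece m (p m) v - piece m (kap (p m)) v
      ?= iff (x == v)].
have /fin_all_exists[pv pvP] (J : {set 'I_n}) :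
    exists pv : {ffun 'I_n -> 'I_K} * 'rV[R]_d, J \in Js -> good J pv.1 pv.2.
  have [|nJ] := boolP (J \in Js); last by exists ([ffun => kap (Ordinal (ltnW K2))], 0).
  rewrite inE finset.subsetC finset.sub1set inE => /andP[mJ /eqP Jd].
  by have [p [v pv]] := bounded_cell kapP mJ Jd; exists (p, v).
pose p J := (pv J).1; pose v J := (pv J).2.
have p_inj : {in Js &, injective p}.
  move=> J J' /pvP[cJ tJ _ lJ] /pvP[cJ' tJ' _ lJ'] e; apply/setP => i.
  rewrite -tJ -tJ'; congr tied; apply/eqP.
  rewrite -/(v J) -/(p J) in cJ lJ *; rewrite -/(v J') -/(p J') in cJ' lJ' *.
  have l1 := lJ' (v J); have l2 := lJ (v J'); rewrite e in l1 l2 cJ.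
  have [l1' <-] := l1 cJ; have [l2' _] := l2 cJ'.
  by rewrite eq_le l1' l2'.
rewrite -(card_in_imset p_inj); apply/subset_leq_card/fintype.subsetP => q /imsetP[J /pvP[cJ _ b _] ->].
by rewrite inE; apply/asboolP; split=> //; exists (v J).
Qed.

End Cells.

Local Open Scope classical_set_scope.

(** * Null sets *)

Section Null.
Variables (R : realType) (D : nat).
Notation V := 'rV[R]_D.+1.
Implicit Types (A B : set V) (P Q : V -> Prop).

Let vol (a b : V) := \prod_i (b 0 i - a 0 i).

Let vol00 : vol 0 0 = 0.
Proof. by rewrite /vol big_ord_recl subrr mul0r. Qed.

Lemma sum_geometric_le (e : R) m : 0 <= e -> \sum_(i < m) e / 2 ^+ i.+1 <= e.
Proof.
move=> e0; suff -> : \sum_(i < m) e / 2 ^+ i.+1 = e - e / 2 ^+ m.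
  by rewrite gerBl divr_ge0 // exprn_ge0.
elim: m => [|m IH]; first by rewrite big_ord0 expr0 divr1 subrr.
by rewrite big_ord_recr /= IH exprS; field; rewrite expf_neq0.
Qed.

Lemma lebesgue_null_bigcup (E : nat -> set V) :
  (forall i, lebesgue_null (E i)) -> lebesgue_null (\bigcup_i E i).
Proof.
move=> nE e e0.
have /choice[ab abP] i : exists ab : nat -> V * V,
    [/\ forall k j, (ab k).1 0 j <= (ab k).2 0 j,
        E i `<=` \bigcup_k box (ab k).1 (ab k).2 &
        forall m, \sum_(k < m) vol (ab k).1 (ab k).2 <= e / 2 ^+ i.+1].
  have [|a [b [h1 [h2 h3]]]] := nE i (e / 2 ^+ i.+1).
    by rewrite divr_gt0 // exprn_gt0.
  by exists (fun k => (a k, b k)).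
pose c k : V * V := if pickle_inv k is Some p then ab p.1 p.2 else (0, 0).
exists (fun k => (c k).1), (fun k => (c k).2); split => [k j|].
  rewrite /c; case: pickle_inv => [p|]; last by rewrite lexx.
  by case: (abP p.1).
split=> [x [i _]|m].
  case: (abP i) => _ H _ /H[k _ xk]; exists (pickle (i, k)) => //.
  by rewrite /c pickleK_inv.
pose F p := vol (ab p.1 p.2).1 (ab p.1 p.2).2.
have F0 p : 0 <= F p.
  by apply: prodr_ge0 => j _; rewrite subr_ge0; case: (abP p.1).
(* All pairs decoded from indices below [m] lie in the square of side [B], over which the volumes
   are summed row by row. *)
pose B := (\max_(k < m) (if pickle_inv k is Some p then maxn p.1 p.2 else 0%N)).+1.
have cE (k : 'I_m) : vol (c k).1 (c k).2 =
    \sum_(p : 'I_B * 'I_B | pickle (p.1 : nat, p.2 : nat) == k) F (p.1 : nat, p.2 : nat).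
  have := @leq_bigmax _ (fun k : 'I_m => if pickle_inv k is Some p then maxn p.1 p.2 else 0%N) k.
  rewrite /c; have := @pickle_invK (nat * nat)%type k.
  case kE: (pickle_inv _) => [[i l]|] /= ek; last first.
    move=> _; rewrite vol00; apply/esym/big_pred0 => p; apply/eqP => e'.
    by rewrite -e' pickleK_inv in kE.
  rewrite -ltnS gtn_max => /andP[iB lB].
  rewrite (big_pred1 (Ordinal iB, Ordinal lB)) // => -[i' l'] /=.
  by rewrite -ek (inj_eq (pcan_inj (@pickleK_inv _))) !xpair_eqE.
rewrite (eq_bigr _ (fun k _ => cE k)) (exchange_big_dep xpredT) //=.
apply: (@le_trans _ _ (\sum_(p : 'I_B * 'I_B) F (p.1 : nat, p.2 : nat))).
  apply: ler_sum => p _; set q := pickle _.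
  rewrite (eq_bigl (fun k : 'I_m => k == q :> nat)) => [|k]; last by rewrite eq_sym.
  have [qm|qm] := ltnP q m; first by rewrite (big_pred1 (Ordinal qm)).
  by rewrite big_pred0 // => k; rewrite ltn_eqF // (leq_trans _ qm).
rewrite -(pair_bigA _ (fun i l : 'I_B => F (i : nat, l : nat))) /=.
apply: le_trans (sum_geometric_le B (ltW e0)); apply: ler_sum => i _.
by case: (abP i) => _ _; apply.
Qed.

Lemma lebesgue_null0 : lebesgue_null (set0 : set V).
Proof.
move=> e e0; exists (fun=> 0), (fun=> 0); split=> [k i|]; first by rewrite lexx.
split=> // m; rewrite big1 ?ltW // => k _; exact: vol00.
Qed.

Lemma ae_forall (I : countType) (P : I -> V -> Prop) :
  (forall i, ae_leb (P i)) -> ae_leb (fun x => forall i, P i x).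
Proof.
move=> /choice[N NP].
exists (\bigcup_k (if unpickle k is Some i then N i else set0)); split.
  apply: lebesgue_null_bigcup => k; case: unpickle => [i|]; last exact: lebesgue_null0.
  by case: (NP i).
move=> x /existsNP[i nPi]; exists (pickle i) => //.
by rewrite pickleK; case: (NP i) => _; apply.
Qed.

Lemma ae_imply P Q : (forall x, P x -> Q x) -> ae_leb P -> ae_leb Q.
Proof.
move=> PQ [N [nN PN]]; exists N; split=> // x nQ.
by apply: PN => /PQ.
Qed.

Lemma ae_and P Q : ae_leb P -> ae_leb Q -> ae_leb (fun x => P x /\ Q x).
Proof.
move=> aP aQ; have := @ae_forall bool (fun b => if b then P else Q).
case=> [[]//|N [nN NP]]; exists N; split=> // x nPQ; apply: NP => H; apply: nPQ.
by split; [apply: (H true)|apply: (H false)].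
Qed.

Lemma grid_cell (h : R) N (t : R) : (0 < N)%N -> 0 <= t -> t <= h * N%:R ->
  exists c : 'I_N, h * c%:R <= t <= h * c.+1%:R.
Proof.
case: N => // N _ t0; elim: N => [|N IH] tN.
  by exists ord0; rewrite mulr0 t0.
have [/IH[c ct]|tN'] := leP t (h * N.+1%:R); first by exists (widen_ord (leqnSn _) c).
by exists ord_max; rewrite tN ltW.
Qed.

(** Split the cube of the other coordinates into [N ^ D] cells of side [h]. Over each the graph fits
    into a box of height [2 * L * h], so the total volume is [C / N]. *)
Lemma null_lipschitz_graph A (j : 'I_D.+1) (M L : R) : 0 < M -> 0 <= L ->
  (forall x, A x -> forall i, `|x 0 i| <= M) ->
  (forall x y (e : R), A x -> A y -> 0 <= e ->
     (forall i, i != j -> `|x 0 i - y 0 i| <= e) -> `|x 0 j - y 0 j| <= L * e) ->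
  lebesgue_null A.
Proof.
move=> M0 L0 AM AL e e0.
pose C := (2 * M) ^+ D * (2 * L) * (2 * M).
have C0 : 0 <= C by rewrite !mulr_ge0 // ?exprn_ge0 // ?mulr_ge0 // ltW.
pose N := (Num.bound (C / e)).+1.
have NC : C / N%:R <= e.
  have N0 : 0 < N%:R :> R by rewrite ltr0n.
  rewrite ler_pdivrMr // -ler_pdivrMl // mulrC.
  have Ce : 0 <= C / e by rewrite divr_ge0 // ltW.
  apply: ltW; apply: lt_trans (archi_boundP Ce) _.
  by rewrite ltr_nat.
pose h := 2 * M / N%:R.
have hN : h * N%:R = 2 * M by rewrite divfK // pnatr_eq0.
have h0 : 0 <= h by rewrite divr_ge0 // mulr_ge0 // ltW.
pose inc (c : {ffun 'I_D -> 'I_N}) (x : V) := A x /\ forall i,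
  - M + h * (c i)%:R <= x 0 (lift j i) <= - M + h * (c i).+1%:R.
(* [z c] is the height of some graph point over the grid cell [c], hence within [L * h] of all of
   them; it is 0 over an empty cell. *)
have /choice[z zP] (c : {ffun 'I_D -> 'I_N}) :
    exists z : R, forall x, inc c x -> `|x 0 j - z| <= L * h.
  have [[y [Ay yc]]|n] := pselect (exists y, inc c y); last first.
    by exists 0 => x xc; case: n; exists x.
  exists (y 0 j) => x [Ax xc]; apply: AL => // i.
  case: (unliftP j i) => [i' ->|->]; last by rewrite eqxx.
  move=> _; have := xc i'; have := yc i'; rewrite -!natr1 ler_norml => /andP[? ?] /andP[? ?].
  by apply/andP; split; lra.
pose lo (c : {ffun 'I_D -> 'I_N}) : V :=
  \row_i if unlift j i is Some i' then - M + h * (c i' : 'I_N)%:R else z c - L * h.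
pose hi (c : {ffun 'I_D -> 'I_N}) : V :=
  \row_i if unlift j i is Some i' then - M + h * (c i' : 'I_N).+1%:R else z c + L * h.
pose T := #|{: {ffun 'I_D -> 'I_N}}|.
pose bx k : V * V := if insub k is Some r then (lo (enum_val (r : 'I_T)), hi (enum_val r)) else (0, 0).
exists (fun k => (bx k).1), (fun k => (bx k).2); split => [k i|].
  rewrite /bx; case: insub => [r|]; last by rewrite lexx.
  rewrite !mxE; case: unlift => [i'|]; first by rewrite -natr1; lra.
  by have := mulr_ge0 L0 h0; lra.
split=> [x Ax|m].
  have /fin_all_exists[c cP] (i : 'I_D) : exists c : 'I_N,
      - M + h * c%:R <= x 0 (lift j i) <= - M + h * c.+1%:R.
    have := AM x Ax (lift j i); rewrite ler_norml => /andP[x1 x2].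
    have [||c /andP[c1 c2]] := @grid_cell h N (x 0 (lift j i) + M) (ltn0Sn _).
    - by lra.
    - by rewrite hN; lra.
    by exists c; apply/andP; split; lra.
  exists (enum_rank (finfun c) : nat) => //.
  have xc : inc (finfun c) x by split=> // i; rewrite ffunE.
  rewrite /bx insubT //= => lt; set r := Sub _ _.
  have -> : r = enum_rank (finfun c) by exact: val_inj.
  rewrite enum_rankK => i; rewrite !mxE.
  case: (unliftP j i) => [i' ->|->]; first by case: xc.
  by have := zP _ _ xc; rewrite ler_norml => /andP[? ?]; apply/andP; split; lra.
have volE c : vol (lo c) (hi c) = 2 * L * h * h ^+ D.
  rewrite /vol (bigD1_ord j) //= !mxE unlift_none; congr (_ * _); first by ring.
  rewrite -[in RHS](card_ord D) -prodr_const; apply: eq_bigr => i _.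
  by rewrite !mxE liftK -natr1; ring.
pose v := 2 * L * h * h ^+ D.
have v0 : 0 <= v.
  by apply: mulr_ge0 (exprn_ge0 _ h0); apply: mulr_ge0 => //; apply: mulr_ge0.
have bxv k : vol (bx k).1 (bx k).2 = if (k < T)%N then v else 0.
  by rewrite /bx; case: insubP => [r -> _|/negPf ->]; rewrite ?volE ?vol00.
rewrite (eq_bigr _ (fun (k : 'I_m) _ => bxv k)).
have -> : \sum_(k < m) (if (k < T)%N then v else 0) = v *+ minn m T.
  elim: m => [|m IH]; first by rewrite big_ord0 min0n.
  rewrite big_ord_recr /= IH; case: ltnP => mT.
    by rewrite (minn_idPl mT) mulrSr.
  by rewrite addr0 (minn_idPr (leqW mT)).
apply: (@le_trans _ _ (v *+ T)); first by rewrite ler_wpMn2l ?geq_minr.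
rewrite /T card_ffun !card_ord -mulr_natr natrX.
suff -> : v * N%:R ^+ D = C / N%:R by [].
by rewrite /v /C -mulrA -exprMn hN /h; ring.
Qed.

(** Lipschitz in the sup norm on every bounded cube, a class that is closed under products, unlike
    that of globally Lipschitz functions. *)
Definition box_lipschitz (f : V -> R) := forall M, exists2 L : R, 0 <= L &
  forall (x y : V) (e : R), (forall i, `|x 0 i| <= M) -> (forall i, `|y 0 i| <= M) ->
    0 <= e -> (forall i, `|x 0 i - y 0 i| <= e) -> `|f x - f y| <= L * e.

Lemma box_lipschitz_bound f M : box_lipschitz f -> exists2 B : R, 0 <= B &
  forall x : V, (forall i, `|x 0 i| <= M) -> `|f x| <= B.
Proof.
move=> /(_ M)[L L0 fL].
have [M0|M0] := leP 0 M; last first.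
  exists 0 => // x /(_ ord0) xM; have := normr_ge0 (x 0 ord0); lra.
exists (L * M + `|f 0|) => [|x xM]; first by rewrite addr_ge0 ?mulr_ge0.
rewrite -{1}(subrK (f 0) (f x)); apply: le_trans (ler_normD _ _) _.
rewrite lerD2r fL // => i; first by rewrite mxE normr0.
by rewrite mxE subr0.
Qed.

Lemma box_lipschitz_cst (c : R) : box_lipschitz (fun=> c).
Proof. by move=> M; exists 0 => // x y e _ _ e0 _; rewrite subrr normr0 mul0r. Qed.

Lemma box_lipschitz_proj i : box_lipschitz (fun x => x 0 i).
Proof. by move=> M; exists 1 => // x y e _ _ e0 xy; rewrite mul1r. Qed.

Lemma box_lipschitzD f g : box_lipschitz f -> box_lipschitz g ->
  box_lipschitz (fun x => f x + g x).
Proof.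
move=> fl gl M; have [L L0 fL] := fl M; have [L' L'0 gL] := gl M.
exists (L + L') => [|x y e xM yM e0 xy]; first exact: addr_ge0.
have := fL _ _ _ xM yM e0 xy; have := gL _ _ _ xM yM e0 xy.
have -> : f x + g x - (f y + g y) = (f x - f y) + (g x - g y) by ring.
have := ler_normD (f x - f y) (g x - g y); rewrite mulrDl; lra.
Qed.

Lemma box_lipschitzM f g : box_lipschitz f -> box_lipschitz g ->
  box_lipschitz (fun x => f x * g x).
Proof.
move=> fl gl M; have [L L0 fL] := fl M; have [L' L'0 gL] := gl M.
have [B B0 fB] := box_lipschitz_bound M fl; have [B' B'0 gB] := box_lipschitz_bound M gl.
exists (L * B' + B * L') => [|x y e xM yM e0 xy]; first by rewrite addr_ge0 ?mulr_ge0.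
have -> : f x * g x - f y * g y = (f x - f y) * g x + f y * (g x - g y) by ring.
apply: le_trans (ler_normD _ _) _; rewrite [leRHS]mulrDl; apply: lerD; rewrite normrM.
  by rewrite mulrAC ler_pM // ?fL ?gB.
by rewrite -mulrA ler_pM // ?gL ?fB.
Qed.

Lemma box_lipschitz_sum (I : Type) (r : seq I) (P : pred I) (f : I -> V -> R) :
  (forall i, box_lipschitz (f i)) -> box_lipschitz (fun x => \sum_(i <- r | P i) f i x).
Proof.
move=> fl; elim: r => [|i r IH].
  under eq_fun do rewrite big_nil; exact: box_lipschitz_cst.
under eq_fun do rewrite big_cons.
by case: (P i) => //; apply: box_lipschitzD.
Qed.

Lemma box_lipschitz_prod (I : Type) (r : seq I) (P : pred I) (f : I -> V -> R) :
  (forall i, box_lipschitz (f i)) -> box_lipschitz (fun x => \prod_(i <- r | P i) f i x).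
Proof.
move=> fl; elim: r => [|i r IH].
  under eq_fun do rewrite big_nil; exact: box_lipschitz_cst.
under eq_fun do rewrite big_cons.
by case: (P i) => //; apply: box_lipschitzM.
Qed.

Lemma ae_neq0_affine (f a : V -> R) (j : 'I_D.+1) : box_lipschitz f ->
  (forall x t, f (x + t *: delta_mx 0 j) = f x + t * a x) ->
  ae_leb (fun x => a x <> 0) -> ae_leb (fun x => f x <> 0).
Proof.
move=> fl fa [N [nN aN]].
pose E n := [set x : V | [/\ forall i, `|x 0 i| <= n.+1%:R, f x = 0 & 1 <= n.+1%:R * `|a x|]].
(* Index 0 takes the null set that contains the zeros of [a]; the others take zeros of [f] in
   growing cubes, with [a] bounded away from 0. *)
exists (\bigcup_n (if n is n'.+1 then E n' else N)); split; last first.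
  move=> x /contrapT fx0; have [a0|a0] := pselect (a x = 0).
    by exists 0%N => //; apply: aN.
  pose M := `|a x|^-1 + \sum_i `|x 0 i|.
  have M0 : 0 <= M by rewrite addr_ge0 ?invr_ge0 ?sumr_ge0.
  have a1 : 0 < `|a x| by rewrite normr_gt0; apply/eqP.
  have Mb : M < (Num.bound M).+1%:R by rewrite (lt_trans (archi_boundP M0)) ?ltr_nat.
  exists (Num.bound M).+1 => //; split=> // [i|].
    apply: le_trans (ltW Mb); rewrite /M (bigD1 i) //= addrCA lerDl.
    by rewrite addr_ge0 ?invr_ge0 ?sumr_ge0.
  rewrite -ler_pdivrMr // mul1r; apply: le_trans (ltW Mb).
  by rewrite lerDl sumr_ge0.
apply: lebesgue_null_bigcup => -[//|n].
have [L L0 fL] := fl n.+1%:R.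
apply: (@null_lipschitz_graph _ j n.+1%:R (n.+1%:R * L)).
- by rewrite ltr0n.
- by rewrite mulr_ge0.
- by move=> x [].
move=> x y e [xn fx ax] [yn fy ay] e0 xy.
(* [w] has coordinate [j] from [y] and the rest from [x]: [f w] is [(y 0 j - x 0 j) * a x] by
   affinity, and small because [w] is close to [y]. *)
pose w := x + (y 0 j - x 0 j) *: delta_mx 0 j.
have wE i : w 0 i = if i == j then y 0 j else x 0 i.
  rewrite !mxE eqxx /=; case: eqP => [->|_]; first by rewrite mulr1 addrC subrK.
  by rewrite mulr0 addr0.
have wn i : `|w 0 i| <= n.+1%:R by rewrite wE; case: ifP.
have : `|f w - f y| <= L * e.
  apply: fL => // i; rewrite wE; case: eqP => [->|/eqP/xy //].
  by rewrite subrr normr0.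
rewrite fa fx fy add0r subr0 normrM distrC => le.
apply: (@le_trans _ _ (n.+1%:R * (`|x 0 j - y 0 j| * `|a x|))).
  by rewrite mulrCA ler_peMr.
by rewrite -mulrA ler_wpM2l.
Qed.

End Null.

(** * Gradients of continuous selections of affine functions *)

Lemma near_fin_forall (T : Type) (F : set_system T) (I : finType)
    (P : I -> T -> Prop) : Filter F ->
  (forall i, \forall x \near F, P i x) -> \forall x \near F, forall i, P i x.
Proof.
move=> FF FP; suff: \forall x \near F, forall i, i \in enum I -> P i x.
  by apply: filterS => x Px i; apply: Px; rewrite mem_enum.
elim: (enum I) => [|i s IH]; first exact: nearW.
move: (FP i) IH; apply: filterS2 => x Pi IH j.
by rewrite in_cons => /orP[/eqP ->|/IH].
Qed.

Section Gradient.
Variables (R : realType) (n : nat).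
Notation V := 'rV[R]_n.
Implicit Types (f : V -> R) (g x v : V).

Lemma dotv_is_linear g : linear_for *%R (dotv g).
Proof. by move=> t x y; rewrite dotvDr dotvZr. Qed.

HB.instance Definition _ g :=
  GRing.isLinear.Build R V R *%R (dotv g) (dotv_is_linear g).

Lemma dotv_continuous g : continuous (dotv g).
Proof.
rewrite /dotv; elim: (index_enum _) => [|i r IH] x.
  have -> : (fun x : V => \sum_(i <- [::]) g 0 i * x 0 i) = cst 0.
    by apply/funext => z; rewrite big_nil.
  exact: cst_continuous.
have -> : (fun x : V => \sum_(i <- i :: r) g 0 i * x 0 i) =
    (fun x => g 0 i * x 0 i + \sum_(i <- r) g 0 i * x 0 i).
  by apply/funext => z; rewrite big_cons.
apply: continuousD (IH x); apply: continuousM; last exact: coord_continuous.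
exact: cst_continuous.
Qed.

Lemma has_grad_near_affine f g c x :
  (\near x, f x = dotv g x + c) -> has_grad f x g.
Proof.
move=> fE; have lin0 : \forall y \near (0 : V), f (y + x) = f x + dotv g y.
  have fx := nbhs_singleton fE; move: fE.
  rewrite (near_shift 0) /= subr0; apply: filterS => y /= fy.
  by rewrite fy fx dotvDr; ring.
have dE : f \o shift x = (cst (f x) + dotv g : V -> R^o) +o_ (0 : V) id.
  apply/eqaddoP => e e0; move: lin0; apply: filterS => y fy.
  have -> : (f \o shift x - (cst (f x) + dotv g)) y = 0.
    by rewrite !fctE /= fy subrr.
  by rewrite normr0 mulr_ge0 // ltW.
have dd : 'd f x = dotv g :> (V -> R).
  by apply: diff_unique => //; exact: dotv_continuous.
have df : differentiable f x.
  by apply/diff_locallyP; rewrite dd; split => //; apply: dotv_continuous.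
by split=> // v; rewrite deriveE // dd.
Qed.

Lemma has_grad_unique f g g' x : has_grad f x g -> has_grad f x g' -> g = g'.
Proof.
move=> [_ fg] [_ fg']; apply/rowP => i.
have := fg (delta_mx 0 i); rewrite fg' (bigD1 i) //= [in RHS](bigD1 i) //= !mxE !eqxx !mulr1.
by rewrite !big1 ?addr0 // => j ji; rewrite !mxE (negPf ji) andbF mulr0.
Qed.

Lemma exists_generic_direction (I : finType) (a : I -> V) :
  exists v, forall i, a i != 0 -> dotv (a i) v != 0.
Proof.
(* A point of the moment curve avoids all the hyperplanes. *)
pose pol i : {poly R} := \sum_(j < n) a i 0 j *: 'X^j.
have pol0 i : a i != 0 -> pol i != 0.
  apply: contraNneq => p0; apply/eqP/rowP => j.
  have := congr1 (fun p : {poly R} => p`_j) p0; rewrite coef0 mxE coef_sum => <-.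
  rewrite (bigD1 j) //= coefZ coefXn eqxx mulr1 big1 ?addr0 // => k kj.
  by rewrite coefZ coefXn eq_sym (negPf (_ : k != j :> nat)) ?mulr0.
pose P := \prod_(i | a i != 0) pol i.
have P0 : P != 0 by apply/prodf_neq0 => i; apply: pol0.
have [t Pt] : exists t : R, ~~ root P t.
  apply: contrapT => /forallNP rP.
  have := @max_poly_roots _ P [seq k%:R | k <- iota 0 (size P)] P0.
  rewrite size_map size_iota ltnn => H; suff: false by [].
  apply: H; first by apply/allP => x _; apply: contrapT => /negP/rP.
  by rewrite map_inj_uniq ?iota_uniq // => i j /eqP; rewrite eqr_nat => /eqP.
exists (\row_j t ^+ j) => i ai; apply: contra Pt => /eqP dt.
rewrite /root /P horner_prod prodf_seq_eq0; apply/hasP; exists i; first exact: mem_index_enum.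
rewrite ai /= -dt horner_sum; apply/eqP; apply: eq_bigr => j _.
by rewrite hornerZ hornerXn mxE.
Qed.

Section Selection.
Variables (f : V -> R) (I : finType) (g : I -> V) (c : I -> R) (C : I -> set V).
Hypothesis fc : continuous f.
Hypothesis Ccl : forall i, closed (C i).
Hypothesis sel : forall x, exists i, C i x /\ f x = dotv (g i) x + c i.

Let on i x := C i x /\ f x = dotv (g i) x + c i.

Let on_near x : \forall z \near x, forall i, on i z -> on i x.
Proof.
apply: (@near_fin_forall _ (nbhs x)) => i.
have [xi|nxi] := pselect (on i x); first by near=> z.
have onc : closed [set z | on i z].
  apply: (@closedI _ (C i) [set z | f z = dotv (g i) z + c i]) => //.
  pose h : V -> R^o := (f : V -> R^o) - ((dotv (g i) : V -> R^o) + cst (c i)).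
  have ch : continuous h.
    move=> z; apply: continuousB; first exact: fc.
    by apply: continuousD; [exact: dotv_continuous | exact: cst_continuous].
  have -> : [set z | f z = dotv (g i) z + c i] = h @^-1` [set y | y = 0].
    apply/seteqP; rewrite /h; split=> z /=; rewrite !fctE.
      by move=> ->; rewrite subrr.
    by move/eqP; rewrite subr_eq0 => /eqP.
  by apply: preimage_closed; [move=> z _; exact: ch | exact: closed_eq].
have : nbhs x (~` [set z | on i z]).
  by apply: open_nbhs_nbhs; split=> //; apply: closed_openC.
by apply: filterS => z nz /nz.
Unshelve. all: by end_near. Qed.

(** At small nonzero parameters of a line in a generic direction, two of the affine functions agree
    only if they are equal. Near such a point [f] is a single affine function. *)
Lemma selection_has_grad (O : set V) : open O -> O !=set0 ->
  exists x i, [/\ O x, C i x & has_grad f x (g i)].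
Proof.
move=> Oo [x0 Ox0].
have [v vP] := exists_generic_direction (fun p : I * I => g p.1 - g p.2).
have nO : \forall t \near (0 : R)^', O (x0 + t *: v).
  have line : (fun s : R => x0 + s *: v) @ (0 : R) --> x0 + 0 *: v.
    by apply: cvgD; [exact: cvg_cst | apply: cvgZl; exact: cvg_id].
  apply: cvg_within; apply: line; rewrite scale0r addr0.
  exact: open_nbhs_nbhs.
pose good t := forall p : I * I,
    dotv (g p.1) (x0 + t *: v) + c p.1 = dotv (g p.2) (x0 + t *: v) + c p.2 ->
    g p.1 = g p.2 /\ c p.1 = c p.2.
have nA : \forall t \near (0 : R)^', good t.
  apply: (@near_fin_forall _ (dnbhs (0 : R))) => p.
  pose al := dotv (g p.1) x0 + c p.1 - (dotv (g p.2) x0 + c p.2).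
  pose be := dotv (g p.1) v - dotv (g p.2) v.
  have E t : dotv (g p.1) (x0 + t *: v) + c p.1 = dotv (g p.2) (x0 + t *: v) + c p.2 ->
      al + t * be = 0.
    by rewrite !dotvDr !dotvZr /al /be => e; lra.
  (* The two functions differ by [al + t * be] on the line. A nonzero [al] excludes small [t], a
     nonzero [be] alone excludes nonzero [t], and if both vanish, genericity of [v] makes the
     functions equal. *)
  have [al0|al0] := eqVneq al 0; last first.
    have lim : (fun s : R => al + s * be) @ (0 : R) --> al + 0 * be.
      by apply: cvgD; [exact: cvg_cst | apply: cvgM; [exact: cvg_id|exact: cvg_cst]].
    rewrite mul0r addr0 in lim; apply: cvg_within.
    by apply: filterS (cvgr_neq0 _ lim al0) => t t0 /E/eqP; rewrite (negPf t0).
  have [be0|be0] := eqVneq be 0.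
    have ge : g p.1 = g p.2.
      apply/eqP; rewrite -subr_eq0; apply/negPn/negP => /(vP p).
      by rewrite dotvBl -/be be0 eqxx.
    by apply: nearW => t _; split => //; move: al0; rewrite /al ge; lra.
  apply: filterS (nbhs_dnbhs_neq (0 : R)) => t t0 /E/eqP.
  by rewrite al0 add0r mulf_eq0 (negPf t0) (negPf be0).
have [t [Ot tA]] : exists t, O (x0 + t *: v) /\ good t.
  by apply: (@filter_ex _ ((0 : R)^')); near=> t; split; near: t.
set x := x0 + t *: v in Ot tA.
have [i [Ci fi]] := sel x.
exists x, i; split=> //; apply: (@has_grad_near_affine _ _ (c i)).
move: (on_near x); apply: filterS => z zx; have [j [Cj fj]] := sel z.
have [_ fx] : on j x by apply: zx.
have [] := tA (i, j); first by rewrite -fi -fx.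
by move=> /= -> ->.
Unshelve. all: by end_near. Qed.

(** Along a direction separating [w] from all other gradients, short difference quotients are slopes
    of functions selected at [y]. They take finitely many values, so the limit must be attained. *)
Lemma has_grad_selected y w : has_grad f y w -> exists2 i, C i y & g i = w.
Proof.
move=> [df Df]; apply: contrapT => nsel.
have [v vP] := exists_generic_direction (fun i => g i - w).
have cvgq : (fun h => h^-1 *: ((f \o shift y) (h *: v) - f y)) @ 0^' --> dotv w v.
  have <- : 'D_v f y = dotv w v by rewrite Df.
  exact: diff_derivable.
have nq : \forall h \near (0 : R)^', forall i, dotv (g i) v != dotv w v ->
   h^-1 *: ((f \o shift y) (h *: v) - f y) != dotv (g i) v.
  apply: (@near_fin_forall _ (dnbhs (0 : R))) => i.
  have [e|ne] := eqVneq (dotv (g i) v) (dotv w v); first exact: nearW.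
  have : nbhs (dotv w v) [set z | z != dotv (g i) v].
    by apply: open_nbhs_nbhs; split; [exact: open_neq | rewrite /= eq_sym].
  by move/cvgq; apply: (@filterS _ (dnbhs (0 : R))) => h + _.
have nt : \forall h \near (0 : R)^', forall i, on i (h *: v + y) -> on i y.
  have line : (fun s : R => y + s *: v) @ (0 : R) --> y + 0 *: v.
    by apply: cvgD; [exact: cvg_cst | apply: cvgZl; exact: cvg_id].
  have : \forall h \near (0 : R)^', forall i, on i (y + h *: v) -> on i y.
    apply: cvg_within; apply: (line (fun z => forall i, on i z -> on i y)).
    by rewrite scale0r addr0; apply: on_near.
  by apply: filterS => h; rewrite addrC.
have [h [h0 hq ht]] : exists h : R, [/\ h != 0, forall i, dotv (g i) v != dotv w v ->
   h^-1 *: ((f \o shift y) (h *: v) - f y) != dotv (g i) v &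
   forall i, on i (h *: v + y) -> on i y].
  apply: (@filter_ex _ ((0 : R)^')); near=> h; split; near: h => //.
  exact: nbhs_dnbhs_neq.
have [i oni] := sel (h *: v + y).
have [Ci fy] := ht i oni.
have gw : dotv (g i) v != dotv w v.
  rewrite -subr_eq0 -dotvBl vP // subr_eq0; apply/eqP => e; apply: nsel; by exists i.
have /negP := hq i gw; apply; apply/eqP.
case: oni => _ /=; rewrite fy dotvDr dotvZr => ->.
by rewrite /GRing.scale /=; field.
Unshelve. all: by end_near. Qed.

End Selection.
End Gradient.

(** * Activation patterns of a network *)

Fixpoint pattern (K : nat) (ws : seq nat) : finType :=
  if ws is n :: ws' then ({ffun 'I_n -> 'I_K} * pattern K ws')%type else unit.

Section Net.
Variables (R : realType) (K : nat).

(** The coefficients of the affine function that results from replacing every maxout unit by the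
    piece that the pattern assigns to it. *)
Fixpoint net_slope (th : nat -> R) (o : nat) (ws : seq nat) (nin : nat) :
    pattern K ws -> nat -> R :=
  match ws return pattern K ws -> nat -> R with
  | [::] => fun _ i => th (o + i)%N
  | n :: ws' => fun q i =>
      \sum_(u < n) net_slope th (o + n * K * nin.+1)%N n q.2 u *
                   th (o + (u * K + q.1 u) * nin.+1 + i)%N
  end.

Fixpoint net_offset (th : nat -> R) (o : nat) (ws : seq nat) (nin : nat) :
    pattern K ws -> R :=
  match ws return pattern K ws -> R with
  | [::] => fun _ => th (o + nin)%N
  | n :: ws' => fun q =>
      \sum_(u < n) net_slope th (o + n * K * nin.+1)%N n q.2 u *
                   th (o + (u * K + q.1 u) * nin.+1 + nin)%N
      + net_offset th (o + n * K * nin.+1)%N n q.2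
  end.

Lemma maxl_map_max (F : nat -> R) : (0 < K)%N ->
  exists k : 'I_K, maxl [seq F k | k <- iota 0 K] = F k /\ forall k' : 'I_K, F k' <= F k.
Proof.
case: K => // K' _ /=.
have foldM (s : seq R) a : a <= foldr Num.max a s /\ {in s, forall b, b <= foldr Num.max a s} /\
    foldr Num.max a s \in a :: s.
  elim: s => [|b s [IH1 [IH2 IH3]]] /=; first by rewrite lexx inE eqxx.
  split; first by rewrite le_max IH1 orbT.
  split=> [b'|]; first by rewrite inE => /orP[/eqP ->|/IH2 H]; rewrite le_max ?lexx ?H ?orbT.
  rewrite /Num.max; case: ifP => _; last by rewrite !inE eqxx orbT.
  by move: IH3; rewrite !inE => /orP[->//|->]; rewrite !orbT.
set s := [seq F k | k <- iota 1 K'].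
have [h1 [h2 h3]] := foldM s (F 0%N).
have : foldr Num.max (F 0%N) s \in [seq F k | k <- iota 0 K'.+1] by [].
case/mapP => k; rewrite mem_iota add0n => /andP[_ kK] e.
exists (Ordinal kK); split=> // k'; rewrite -[F (Ordinal kK)]e.
have : F k' \in F 0%N :: s.
  by apply: (map_f F (_ : (k' : nat) \in iota 0 K'.+1)); rewrite mem_iota add0n ltn_ord.
by rewrite inE => /orP[/eqP ->|/h2].
Qed.

Lemma dotlE (w : nat -> R) (x : seq R) n : size x = n ->
  dotl w x = \sum_(i < n) w i * nth 0 x i.
Proof. by move=> <-. Qed.

Lemma size_layer_eval th o n x : size (layer_eval K th o n x : seq R) = n.
Proof. by rewrite size_map size_iota. Qed.

Lemma nth_layer_eval th o n x nin (j : 'I_n) : size x = nin ->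
  nth 0 (layer_eval K th o n x) j =
  maxl [seq \sum_(i < nin) th (o + (j * K + k) * nin.+1 + i)%N * nth 0 x i
            + th (o + (j * K + k) * nin.+1 + nin)%N | k <- iota 0 K] :> R.
Proof.
by move=> <-; rewrite (nth_map 0%N) ?size_iota // nth_iota.
Qed.

Definition preactivation (th : nat -> R) (o nin : nat) (x : seq R) (u k : nat) : R :=
  \sum_(i < nin) th (o + (u * K + k) * nin.+1 + i)%N * nth 0 x i
  + th (o + (u * K + k) * nin.+1 + nin)%N.

Definition first_layer_max (th : nat -> R) (o nin : nat) (x : seq R) (ws : seq nat) :
    pattern K ws -> Prop :=
  match ws return pattern K ws -> Prop with
  | [::] => fun _ => True
  | n :: _ => fun q => forall (u : 'I_n) (k : 'I_K),
      preactivation th o nin x u k <= preactivation th o nin x u (q.1 u)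
  end.

Lemma net_eval_pattern (th : nat -> R) (o : nat) ws nin (x : seq R) :
  (0 < K)%N -> size x = nin -> exists q : pattern K ws,
  first_layer_max th o nin x q /\
  net_eval K th o ws x =
    \sum_(i < nin) net_slope th o nin q i * nth 0 x i + net_offset th o nin q.
Proof.
move=> K0; elim: ws o nin x => [|n ws IH] o nin x sx.
  by exists tt; rewrite /= (dotlE _ sx) sx.
have [q [_ Eq]] := IH (o + n * K * nin.+1)%N n (layer_eval K th o n x) (size_layer_eval _ _ _ _).
have /fin_all_exists[p pP] (u : 'I_n) := maxl_map_max (preactivation th o nin x u) K0.
exists (finfun p, q); split=> /= [u k|]; first by rewrite ffunE; case: (pP u).
rewrite sx Eq addrA; congr (_ + _).
transitivity (\sum_(u < n) net_slope th (o + n * K * nin.+1) n q u *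
    preactivation th o nin x u (p u)).
  apply: eq_bigr => u _; rewrite (nth_layer_eval _ _ _ sx).
  by have [-> _] := pP u.
rewrite /preactivation; under [LHS]eq_bigr do rewrite mulrDr.
rewrite big_split /=; congr (_ + _); last by apply: eq_bigr => u _; rewrite ffunE.
under eq_bigr do rewrite mulr_sumr; rewrite exchange_big /=.
apply: eq_bigr => i _; rewrite mulr_suml; apply: eq_bigr => u _.
by rewrite ffunE mulrA.
Qed.

Lemma net_slope_ext (th th' : nat -> R) o ws nin (q : pattern K ws) i :
  (forall k, (o <= k)%N -> th k = th' k) -> net_slope th o nin q i = net_slope th' o nin q i.
Proof.
elim: ws o nin q i => [|n ws IH] o nin q i e /=; first by rewrite e ?leq_addr.
apply: eq_bigr => u _; rewrite e -?addnA ?leq_addr //; congr (_ * _).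
by apply: IH => k ok; apply: e; apply: leq_trans ok; apply: leq_addr.
Qed.

Lemma net_eval_continuous (T : topologicalType) (th : nat -> R) o ws nin (X : T -> seq R) :
  (forall v, size (X v) = nin) -> (forall i, continuous (fun v => nth 0 (X v) i : R^o)) ->
  continuous (fun v => net_eval K th o ws (X v) : R^o).
Proof.
have dotl_cont (w : nat -> R) m (Y : T -> seq R) :
    (forall v, size (Y v) = m) -> (forall i, continuous (fun v => nth 0 (Y v) i : R^o)) ->
    continuous (fun v => dotl w (Y v) : R^o).
  move=> sY cY.
  have -> : (fun v => dotl w (Y v) : R^o) = (fun v => \sum_(i < m) w i * nth 0 (Y v) i).
    by apply/funext => v; rewrite (dotlE _ (sY v)).
  elim: (index_enum _) => [|i r IH] x.
    have -> : (fun v : T => \sum_(i <- [::]) w (i : 'I_m) * nth 0 (Y v) i : R^o) = cst 0.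
      by apply/funext => z; rewrite big_nil.
    exact: cst_continuous.
  have -> : (fun v : T => \sum_(i <- i :: r) w i * nth 0 (Y v) i : R^o) =
      (fun v => w i * nth 0 (Y v) i + \sum_(i <- r) w i * nth 0 (Y v) i).
    by apply/funext => z; rewrite big_cons.
  apply: continuousD (IH x); apply: continuousM; last exact: cY.
  exact: cst_continuous.
have affine_cont (w : nat -> R) (b : nat -> R) m (Y : T -> seq R) :
    (forall v, size (Y v) = m) -> (forall i, continuous (fun v => nth 0 (Y v) i : R^o)) ->
    continuous (fun v => dotl w (Y v) + b (size (Y v)) : R^o).
  move=> sY cY.
  have -> : (fun v => dotl w (Y v) + b (size (Y v)) : R^o) = (fun v => dotl w (Y v) + b m).
    by apply/funext => v; rewrite sY.
  move=> x; apply: continuousD; last exact: cst_continuous.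
  exact: dotl_cont sY cY x.
elim: ws o nin X => [|n ws IH] o nin X sX cX.
  exact: (affine_cont _ (fun k => th (o + k)%N) _ _ sX cX).
have -> : (fun v => net_eval K th o (n :: ws) (X v) : R^o) =
    (fun v => net_eval K th (o + n * K * nin.+1)%N ws (layer_eval K th o n (X v))).
  by apply/funext => v; rewrite /= sX.
apply: (IH _ n) => [v|i]; first by rewrite size_layer_eval.
have [ni|ni] := leqP n i.
  have -> : (fun v => nth 0 (layer_eval K th o n (X v)) i : R^o) = cst 0.
    by apply/funext => v; rewrite nth_default // size_layer_eval.
  exact: cst_continuous.
pose F k v : R^o := dotl (fun j => th (o + (i * K + k) * nin.+1 + j)%N) (X v)
  + th (o + (i * K + k) * nin.+1 + size (X v))%N.
have -> : (fun v => nth 0 (layer_eval K th o n (X v)) i : R^o) =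
    (fun v => maxl [seq F k v | k <- iota 0 K]).
  by apply/funext => v; rewrite (nth_map 0%N) ?size_iota // nth_iota // /F sX.
have cF k : continuous (F k).
  exact: (affine_cont _ (fun j => th (o + (i * K + k) * nin.+1 + j)%N) _ _ sX cX).
case: (iota 0 K) => [|k s] /=; first exact: cst_continuous.
elim: s => [|k' s IHs] /=; first exact: cF.
move=> x; apply: (@continuous_max R T (F k') _ x); [exact: cF | exact: IHs].
Qed.

End Net.

(** * Genericity for almost every parameter *)

(** Units, pieces and columns are encoded by quotient and remainder, so distinct weights have
    distinct parameter indices. *)
Lemma eq_mulnDl m a a' c c' : (c < m)%N -> (c' < m)%N ->
  (a * m + c == a' * m + c')%N = (a == a') && (c == c').
Proof.
move=> cm c'm; apply/eqP/andP => [e|[/eqP -> /eqP ->]] //.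
have m0 : (0 < m)%N by apply: leq_ltn_trans cm.
have := congr1 (divn^~ m) e; rewrite !divnMDl // !divn_small // !addn0 => ea.
by move: e; rewrite ea => /addnI ->; rewrite !eqxx.
Qed.

Section Slope.
Variables (R : realType) (K : nat).

(** A weight of the current layer enters linearly, and only if the pattern selects its piece; its
    factor is a slope of the later layers, which do not read that parameter. *)
Lemma net_slope_shift (th th' : nat -> R) t o n ws nin (pq : pattern K (n :: ws)) i
    (u : 'I_n) (k : 'I_K) : (i <= nin)%N ->
  (forall m, th' m = th m + t * (m == o + (u * K + k) * nin.+1 + i)%N%:R) ->
  net_slope th' o nin pq i = net_slope th o nin pq i +
    t * ((pq.1 u == k)%:R * net_slope th (o + n * K * nin.+1) n pq.2 u).
Proof.
move=> ilt thE; case: pq => p q /=.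
have lt : (o + (u * K + k) * nin.+1 + i < o + n * K * nin.+1)%N.
  have uk : (u * K + k < n * K)%N.
    apply: (@leq_trans (u.+1 * K)); first by rewrite mulSn addnC ltn_add2r.
    by rewrite leq_mul2r ltn_ord orbT.
  rewrite -addnA ltn_add2l; apply: (@leq_trans ((u * K + k).+1 * nin.+1)).
    by rewrite mulSn addnC ltn_add2r.
  by rewrite leq_mul2r uk orbT.
have tail (v : 'I_n) : net_slope th' (o + n * K * nin.+1) n q v =
    net_slope th (o + n * K * nin.+1) n q v.
  apply: net_slope_ext => m om; rewrite thE gtn_eqF ?mulr0 ?addr0 //.
  exact: leq_trans lt om.
have idx (v : 'I_n) : (o + (v * K + p v) * nin.+1 + i == o + (u * K + k) * nin.+1 + i)%N
    = (v == u) && (p v == k).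
  by rewrite eqn_add2r eqn_add2l eqn_pmul2r // eq_mulnDl.
under eq_bigr => v _ do rewrite tail thE idx mulrDr.
rewrite big_split /=; congr (_ + _).
rewrite (bigD1 u) //= eqxx /= big1 ?addr0 => [|v /negPf ->]; last by rewrite !mulr0.
by ring.
Qed.

Section AE.
Variable D : nat.
Notation V := 'rV[R]_D.+1.

Lemma coord_shift (x : V) t (j : 'I_D.+1) k :
  Defs.coord (x + t *: delta_mx 0 j) k = Defs.coord x k + t * (k == j)%:R.
Proof.
rewrite /Defs.coord; case: insubP => [i _ <-|kD]; first by rewrite !mxE.
rewrite gtn_eqF ?mulr0 ?addr0 //; apply: leq_trans (ltn_ord j) _.
by rewrite leqNgt.
Qed.

Lemma box_lipschitz_coord k : box_lipschitz (fun x : V => Defs.coord x k).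
Proof.
rewrite /Defs.coord; case: insub => [i|]; first exact: box_lipschitz_proj.
exact: box_lipschitz_cst.
Qed.

Lemma box_lipschitz_slope o ws nin (q : pattern K ws) i :
  box_lipschitz (fun x : V => net_slope (Defs.coord x) o nin q i).
Proof.
elim: ws o nin q i => [|n ws IH] o nin q i /=; first exact: box_lipschitz_coord.
apply: box_lipschitz_sum => u; apply: box_lipschitzM; first exact: IH.
exact: box_lipschitz_coord.
Qed.

Lemma ae_true (P : V -> Prop) : (forall x, P x) -> ae_leb P.
Proof.
by move=> H; exists set0; split=> [|x nP]; [exact: lebesgue_null0 | case: nP].
Qed.

(** Induction over the layers: the slope is affine in a weight of the piece selected for the first
    unit, with a slope of the remaining network as coefficient. At the output layer the slope is
    itself a parameter. *)
Lemma ae_slope_neq0 o ws nin (q : pattern K ws) i : all (fun n => 0 < n)%N ws ->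
  (i < nin)%N -> (o + nparams K nin ws <= D.+1)%N ->
  ae_leb (fun x : V => net_slope (Defs.coord x) o nin q i <> 0).
Proof.
elim: ws o nin q i => [|n ws IH] o nin q i /= ws0 ilt oD.
  have jD : (o + i < D.+1)%N by apply: leq_trans oD; rewrite ltn_add2l ltnS ltnW.
  apply: (@ae_neq0_affine _ _ _ (fun=> 1) (Ordinal jD)).
  - exact: box_lipschitz_coord.
  - by move=> x t; rewrite coord_shift eqxx.
  by apply: ae_true => x; apply/eqP; rewrite oner_eq0.
case/andP: ws0 => n0 ws0; pose u := Ordinal n0; pose k := q.1 u.
have jD : (o + (u * K + k) * nin.+1 + i < D.+1)%N.
  apply: leq_trans oD; rewrite -addnA ltn_add2l.
  have uk : (u * K + k < n * K)%N.
    apply: (@leq_trans (u.+1 * K)); first by rewrite mulSn addnC ltn_add2r.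
    by rewrite leq_mul2r ltn_ord orbT.
  apply: (@leq_trans ((u * K + k).+1 * nin.+1)).
    by rewrite mulSn addnC ltn_add2r ltnS ltnW.
  by apply: leq_trans (leq_addr _ _); rewrite leq_mul2r uk orbT.
apply: (@ae_neq0_affine _ _ _
  (fun x => net_slope (Defs.coord x) (o + n * K * nin.+1) n q.2 u) (Ordinal jD)).
- exact: (@box_lipschitz_slope o (n :: ws)).
- move=> x t; have := @net_slope_shift (Defs.coord x) _ t o n ws nin q i u k (ltnW ilt)
    (fun m => coord_shift x t (Ordinal jD) m).
  by rewrite eqxx mul1r.
by apply: IH => //; rewrite -addnA.
Qed.

(** At a unit where the patterns differ, the weight selected by [q] at input 0 enters only the first
    slope, so the difference is affine in it with an almost everywhere nonzero coefficient. *)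
Lemma ae_slope_neq n0 n1 ns (q q' : pattern K (n1 :: ns)) : all (fun n => 0 < n)%N ns ->
  (nparams K n0 (n1 :: ns) <= D.+1)%N -> q.1 <> q'.1 ->
  ae_leb (fun x : V => net_slope (Defs.coord x) 0 n0 q 0 <> net_slope (Defs.coord x) 0 n0 q' 0).
Proof.
move=> ns0 /= nD qq'.
have [u qu] : exists u, q.1 u != q'.1 u.
  by apply: contrapT => /forallNP h; apply: qq'; apply/ffunP => u; apply/eqP/negPn/negP/h.
set k := q.1 u in qu.
have uk : (u * K + k < n1 * K)%N.
  apply: (@leq_trans (u.+1 * K)); first by rewrite mulSn addnC ltn_add2r.
  by rewrite leq_mul2r ltn_ord orbT.
have jD : (0 + (u * K + k) * n0.+1 + 0 < D.+1)%N.
  rewrite add0n addn0; apply: leq_trans nD; apply: (@leq_trans ((u * K + k).+1 * n0.+1)).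
    by rewrite mulSn -[ltnLHS]add0n ltn_add2r.
  by apply: leq_trans (leq_addr _ _); rewrite leq_mul2r uk orbT.
apply: (@ae_imply _ _ (fun x => net_slope (Defs.coord x) 0 n0 q 0 +
    (-1) * net_slope (Defs.coord x) 0 n0 q' 0 <> 0)).
  by move=> x h e; apply: h; move: e => /= ->; rewrite mulN1r subrr.
apply: (@ae_neq0_affine _ _ _
  (fun x => net_slope (Defs.coord x) (0 + n1 * K * n0.+1) n1 q.2 u) (Ordinal jD)).
- apply: box_lipschitzD; first exact: (@box_lipschitz_slope 0 (n1 :: ns)).
  apply: box_lipschitzM; first exact: box_lipschitz_cst.
  exact: (@box_lipschitz_slope 0 (n1 :: ns)).
- move=> x t; have sh m := coord_shift x t (Ordinal jD) m.
  have := @net_slope_shift (Defs.coord x) _ t 0 n1 ns n0 q 0 u k isT sh.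
  have := @net_slope_shift (Defs.coord x) _ t 0 n1 ns n0 q' 0 u k isT sh.
  rewrite eqxx eq_sym (negPf qu) mul0r mulr0 addr0 mul1r => -> ->.
  by rewrite addrAC.
by apply: ae_slope_neq0.
Qed.

Lemma box_lipschitz_det s (A : V -> 'M[R]_s) :
  (forall i j, box_lipschitz (fun x => A x i j)) -> box_lipschitz (fun x => \det (A x)).
Proof.
move=> Al; apply: box_lipschitz_sum => g; apply: box_lipschitzM.
  exact: box_lipschitz_cst.
exact: box_lipschitz_prod.
Qed.

Definition first_layer n d (th : nat -> R) (i : 'I_n) (k : 'I_K) (c : nat) : R :=
  th ((i * K + k) * d.+1 + c)%N.

(** Induction on the size: the determinant is affine in the parameter behind its bottom right entry,
    and the coefficient is the leading minor, a determinant of the same form. *)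
Lemma ae_generic n d : (n * K * d.+1 <= D.+1)%N ->
  ae_leb (fun x : V => generic d (first_layer d (Defs.coord x) : 'I_n -> 'I_K -> nat -> R)).
Proof.
move=> nD.
pose M s (k0 : 'I_n -> 'I_K) (e : 'I_s -> 'I_n * 'I_K) (x : V) := \matrix_(r < s, c < s)
  (first_layer d (Defs.coord x) (e r).1 (e r).2 c - first_layer d (Defs.coord x) (e r).1 (k0 (e r).1) c).
suff detM s (k0 : 'I_n -> 'I_K) (e : 'I_s -> 'I_n * 'I_K) : (s <= d.+1)%N -> injective e ->
    (forall r, (e r).2 != k0 (e r).1) -> ae_leb (fun x => \det (M s k0 e x) <> 0).
  apply: (@ae_imply _ _ (fun x => forall s : 'I_d.+2, forall k0 : {ffun 'I_n -> 'I_K},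
      forall e : {ffun 'I_s -> 'I_n * 'I_K}, injective e -> (forall r, (e r).2 != k0 (e r).1) ->
      \det (M s k0 e x) <> 0)).
    move=> x H s k0 e sd ie ne; apply/eqP.
    have sd' : (s < d.+2)%N by [].
    exact: (H (Ordinal sd') k0 e ie ne).
  apply: ae_forall => s; apply: ae_forall => k0; apply: ae_forall => e.
  have [ie|ie] := pselect (injective e); last by apply: ae_true.
  have [ne|ne] := pselect (forall r, (e r).2 != k0 (e r).1); last by apply: ae_true.
  have sd : (s <= d.+1)%N by rewrite -ltnS.
  by apply: ae_imply (detM s k0 e sd ie ne).
elim: s e => [|s IH] e sd ie ne.
  by apply: ae_true => x; rewrite det_mx00; apply/eqP; rewrite oner_eq0.
pose z := e ord_max.
have uk (i : 'I_n) (k : 'I_K) : (i * K + k < n * K)%N.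
  apply: (@leq_trans (i.+1 * K)); first by rewrite mulSn addnC ltn_add2r.
  by rewrite leq_mul2r ltn_ord orbT.
have jD : ((z.1 * K + z.2) * d.+1 + s < D.+1)%N.
  apply: leq_trans nD; apply: (@leq_trans ((z.1 * K + z.2).+1 * d.+1)).
    by rewrite mulSn addnC ltn_add2r.
  by rewrite leq_mul2r uk orbT.
pose e' r := e (lift ord_max r).
apply: (@ae_neq0_affine _ _ _ (fun x => \det (M s k0 e' x)) (Ordinal jD)).
- apply: box_lipschitz_det => i j.
  have -> : (fun x => M s.+1 k0 e x i j) = (fun x =>
    first_layer d (Defs.coord x) (e i).1 (e i).2 j +
    (-1) * first_layer d (Defs.coord x) (e i).1 (k0 (e i).1) j).
    by apply/funext => x; rewrite mxE mulN1r.
  apply: box_lipschitzD; first exact: box_lipschitz_coord.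
  by apply: box_lipschitzM; [exact: box_lipschitz_cst | exact: box_lipschitz_coord].
- move=> x t; set x' := x + _.
  (* The parameter occurs in the corner only: [z.2] is not the reference piece of [z.1], and the
     other rows belong to other pairs because [e] is injective. *)
  have entry r c : M s.+1 k0 e x' r c = M s.+1 k0 e x r c + t * ((r == ord_max) && (c == ord_max))%:R.
    rewrite !mxE /first_layer !coord_shift /=.
    have cs (c' : 'I_s.+1) : (c' < d.+1)%N by apply: leq_trans sd.
    rewrite !eq_mulnDl ?cs //.
    have kne : ((e r).1 == z.1) && (k0 (e r).1 == z.2) = false.
      by apply/negP => /andP[/eqP e1 /eqP e2]; have := ne ord_max; rewrite -/z -e1 e2 eqxx.
    rewrite -[(e r).1 == z.1 :> nat]/((e r).1 == z.1) -[(k0 _ == z.2 :> nat)]/(k0 (e r).1 == z.2) kne.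
    rewrite -[(e r).2 == z.2 :> nat]/((e r).2 == z.2) -xpair_eqE -!surjective_pairing (inj_eq ie).
    by rewrite mulr0 addr0 addrAC.
  rewrite (expand_det_row _ ord_max) [X in _ = X + _](expand_det_row _ ord_max).
  have cof c : cofactor (M s.+1 k0 e x') ord_max c = cofactor (M s.+1 k0 e x) ord_max c.
    rewrite /cofactor; congr (_ * \det _); apply/matrixP => r c'.
    rewrite mxE mxE entry eq_sym (negPf (neq_lift _ _)) mulr0 addr0 [in RHS]mxE.
    by rewrite [in RHS]mxE.
  under eq_bigr => c _ do rewrite cof entry eqxx mulrDl.
  rewrite big_split /=; congr (_ + _).
  rewrite (bigD1 ord_max) //= eqxx mulr1 big1 ?addr0 => [|c /negPf ->]; last by rewrite mulr0 mul0r.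
  rewrite /cofactor -signr_odd addnn odd_double expr0 mul1r; congr (_ * \det _).
  apply/matrixP => r c; rewrite !mxE lift_max; by [].
apply: IH; first exact: ltnW.
  by move=> r r' /ie/lift_inj.
by move=> r; apply: ne.
Qed.

End AE.
End Slope.

(** * Linear regions *)

(** Gradients are unique, so a larger connected set with constant gradient has gradient [g] as well
    and lies in the same component. *)
Lemma linear_region_component (R : realType) n (f : 'rV[R]_n -> R) x g :
  has_grad f x g -> linear_region f (connected_component [set z | has_grad f z g] x).
Proof.
move=> fx; split; first by exists x; apply: connected_component_refl.
split; first exact: component_connected.
split; first by exists g => z /connected_component_sub.
move=> W subW cW [g' gW]; apply/seteqP; split=> //.
have Wx : W x by apply/subW/connected_component_refl.
apply: connected_component_max => // z /gW.
by rewrite (has_grad_unique (gW x Wx) fx).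
Qed.

Section Regions.
Variables (R : realType) (K n0 n1 : nat) (ns : seq nat) (th : nat -> R).
Hypothesis K2 : (2 <= K)%N.
Let f (x : 'rV[R]_n0) := net_eval K th 0 (n1 :: ns) [seq x 0 i | i <- enum 'I_n0].
Let U : 'I_n1 -> 'I_K -> nat -> R := first_layer n0 th.
Hypothesis gen : generic n0 U.
Hypothesis slope_neq : (0 < n0)%N -> forall q q' : pattern K (n1 :: ns), q.1 <> q'.1 ->
  net_slope th 0 n0 q 0 <> net_slope th 0 n0 q' 0.

Let grad (q : pattern K (n1 :: ns)) : 'rV[R]_n0 := \row_i net_slope th 0 n0 q i.
Let offset (q : pattern K (n1 :: ns)) : R := net_offset th 0 n0 q.
Let C (q : pattern K (n1 :: ns)) : set 'rV[R]_n0 := [set x | cell U q.1 x].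

Let size_input (x : 'rV[R]_n0) : size [seq x 0 i | i <- enum 'I_n0] = n0.
Proof. by rewrite size_map size_enum_ord. Qed.

Let nth_input (x : 'rV[R]_n0) (i : 'I_n0) : nth 0 [seq x 0 i | i <- enum 'I_n0] i = x 0 i.
Proof. by rewrite (nth_map i) ?size_enum_ord // nth_ord_enum. Qed.

Let preactivationE (x : 'rV[R]_n0) (u : 'I_n1) (k : 'I_K) :
  preactivation K th 0 n0 [seq x 0 i | i <- enum 'I_n0] u k = @piece R n1 K n0 U u k x.
Proof.
rewrite /preactivation /piece; congr (_ + _).
by apply: eq_bigr => i _; rewrite nth_input mxE.
Qed.

Let f_sel (x : 'rV[R]_n0) : exists q, C q x /\ f x = dotv (grad q) x + offset q.
Proof.
have [q [mq Eq]] := net_eval_pattern th 0 (n1 :: ns) (ltnW K2) (size_input x).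
exists q; split.
  move=> u; apply/activeP => k; rewrite -!preactivationE; exact: mq.
rewrite /f Eq; congr (_ + _); apply: eq_bigr => i _.
by rewrite nth_input mxE.
Qed.

Let f_cont : continuous f.
Proof.
apply: (@net_eval_continuous R K _ th 0 (n1 :: ns) n0) => [x|i]; first exact: size_input.
have [ni|ni] := leqP n0 i.
  have -> : (fun v : 'rV[R]_n0 => nth 0 [seq v 0 i | i <- enum 'I_n0] i : R^o) = cst 0.
    by apply/funext => v; rewrite nth_default // size_input.
  exact: cst_continuous.
have -> : (fun v : 'rV[R]_n0 => nth 0 [seq v 0 i | i <- enum 'I_n0] i : R^o) =
    (fun v => v 0 (Ordinal ni)).
  by apply/funext => v; rewrite (nth_input v (Ordinal ni)).
exact: coord_continuous.
Qed.

Let C_closed q : closed (C q).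
Proof.
have -> : C q = \bigcap_(z in [set: 'I_n1 * 'I_K])
    [set x | dotv (piece_lin n0 U z.1 z.2 - piece_lin n0 U z.1 (q.1 z.1)) x <=
             U z.1 (q.1 z.1) n0 - U z.1 z.2 n0].
  apply/seteqP; split=> x /= Cx.
    move=> [i k] _ /=; rewrite dotvBl.
    by have /activeP/(_ k) := Cx i; rewrite /piece; lra.
  move=> i; apply/activeP => k; have /= := Cx (i, k) I; rewrite dotvBl /piece; lra.
apply: closed_bigI => z _.
set a := piece_lin _ _ _ _ - _; set b := U _ _ _ - _.
have -> : [set x | dotv a x <= b] = (dotv a : _ -> R^o) @^-1` [set y | y <= b] by [].
by apply: preimage_closed; [move=> x _; exact: dotv_continuous | exact: closed_le].
Qed.

Let cell_gradient (p : {ffun 'I_n1 -> 'I_K}) : (exists x, @cell R n1 K n0 U p x) ->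
  exists x q, q.1 = p /\ has_grad f x (grad q).
Proof.
move=> [x0 px0]; have [x1 px1] := open_cell gen px0.
(* The complement of all other closed cells is open and contains the point [x1] of strict
   maximality. *)
pose O := [set x : 'rV[R]_n0 | forall p' : {ffun 'I_n1 -> 'I_K}, p' != p -> ~ cell U p' x].
have oO : open O.
  rewrite openE => x Ox; apply: (@near_fin_forall _ (nbhs x)) => p'.
  have [->|p'p] := eqVneq p' p; first exact: nearW.
  (* Only the later layers of [q0] matter: they complete [p'] to a full pattern. *)
  have [q0 _] := f_sel x0.
  have : nbhs x (~` C (p', q0.2)).
    by apply: open_nbhs_nbhs; split; [exact/closed_openC/C_closed | exact: Ox].
  by apply: filterS.
have Ox1 : O x1.
  move=> p' p'p cp'; move/eqP: p'p; apply; apply/ffunP => i; apply: contrapT => /eqP ne.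
  by have /activeP/(_ (p i)) := cp' i; rewrite leNgt px1.
have [x [q [Ox Cq fq]]] := selection_has_grad f_cont C_closed f_sel oO (ex_intro _ _ Ox1).
exists x, q; split=> //; apply/eqP/negPn/negP => /Ox; exact.
Qed.

(** Some pattern selected at [z] has the gradient of [q], and the gradient determines the
    first-layer part of a pattern. *)
Let grad_cell (q : pattern K (n1 :: ns)) z : (0 < n0)%N ->
  has_grad f z (grad q) -> cell U q.1 z.
Proof.
move=> n00 /(has_grad_selected f_cont C_closed f_sel)[q' Cq' e].
suff <- : q'.1 = q.1 by [].
apply: contrapT => /(slope_neq n00); apply.
by have := congr1 (fun v : 'rV_n0 => v 0 (Ordinal n00)) e; rewrite !mxE.
Qed.

(** A region determines its gradient and thereby its cell, which gives injectivity; the inclusion in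
    the cell transfers boundedness. *)
Lemma at_least_regions_of_cells N (P : {set {ffun 'I_n1 -> 'I_K}}) : (0 < n0)%N ->
  (N <= #|P|)%N -> (forall p, p \in P -> exists x, @cell R n1 K n0 U p x) ->
  exists r : 'I_N -> set 'rV[R]_n0, injective r /\ forall i, linear_region f (r i) /\
    exists2 p, p \in P & r i `<=` cell U p.
Proof.
move=> n00 NP cP.
have /choice[xq xqP] (i : 'I_N) : exists xq : 'rV[R]_n0 * pattern K (n1 :: ns),
    xq.2.1 = enum_val (widen_ord NP i) /\ has_grad f xq.1 (grad xq.2).
  have [x [q H]] := cell_gradient (cP _ (enum_valP (widen_ord NP i))).
  by exists (x, q).
exists (fun i => connected_component [set z | has_grad f z (grad (xq i).2)] (xq i).1).
split=> [i j e|i]; last first.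
  have [qE gq] := xqP i; split; first exact: linear_region_component.
  exists (enum_val (widen_ord NP i)); first exact: enum_valP.
  by move=> z /connected_component_sub/(grad_cell n00); rewrite qE.
have [qi gi] := xqP i; have [qj gj] := xqP j.
have gij : has_grad f (xq i).1 (grad (xq j).2).
  have : connected_component [set z | has_grad f z (grad (xq i).2)] (xq i).1 (xq i).1.
    exact: connected_component_refl.
  by rewrite e => /connected_component_sub.
have ee := has_grad_unique gi gij.
suff : enum_val (widen_ord NP i) = enum_val (widen_ord NP j).
  by move=> /enum_val_inj[] /ord_inj.
rewrite -qi -qj; apply: contrapT => /(slope_neq n00); apply.
by have := congr1 (fun v : 'rV_n0 => v 0 (Ordinal n00)) ee; rewrite !mxE.
Qed.

Lemma generic_net_regions : (0 < n1)%N ->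
  at_least_regions f (\sum_(j < n0.+1) 'C(n1, j)) /\
  at_least_bounded_regions f 'C(n1.-1, n0).
Proof.
move=> n10; have cc := count_cells gen K2; have cb := count_bounded_cells gen K2 n10.
have [n00|n00] := posnP n0; last first.
  split.
    have [|r [ir rP]] := at_least_regions_of_cells n00 cc.
      by move=> p; rewrite inE => /asboolP.
    by exists r; split=> // i; case: (rP i).
  have [|r [ir rP]] := at_least_regions_of_cells n00 cb.
    by move=> p; rewrite inE => /asboolP[].
  exists r; split=> // i; have [lr [p pP rp]] := rP i; split=> //.
  move: pP; rewrite inE => /asboolP[_ [M pM]]; exists M => x /rp; exact: pM.
(* For [n0 = 0] all gradients coincide and cannot separate cells, but both counts are 1, so a single
   region suffices. *)
have [x [q [_ gx]]] : exists x q, q.1 = q.1 /\ has_grad f x (grad q).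
  have [p] : exists p, p \in [set p | `[< exists x, @cell R n1 K n0 U p x >]]%SET.
    apply/set0Pn; rewrite -card_gt0; apply: leq_trans cc.
    by rewrite big_ord_recl bin0.
  rewrite inE => /asboolP/cell_gradient[x [q [_ gx]]]; by exists x, q.
have lr := linear_region_component gx.
set U0 := connected_component _ _ in lr.
have s1 : (\sum_(j < n0.+1) 'C(n1, j) = 1)%N by rewrite n00 big_ord1 bin0.
have c1 : ('C(n1.-1, n0) = 1)%N by rewrite n00 bin0.
rewrite s1 c1; split; exists (fun=> U0); split=> [i j _|i]; rewrite ?ord1 //.
split=> //; exists 0 => z _ j.
by have := ltn_ord j; rewrite {2}n00.
Qed.

End Regions.

(** The lemmas on null sets are stated in dimension [D.+1]; a variable [D] equal to the parameter
    count lets case analysis expose the successor. *)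
Lemma ae_net_regions (R : realType) (K n0 n1 : nat) (ns : seq nat) (D : nat) :
  (2 <= K)%N -> (0 < n1)%N -> all (fun n => 0 < n)%N ns ->
  D = nparams K n0 (n1 :: ns) ->
  ae_leb (fun theta : 'rV[R]_D =>
    at_least_regions (maxout_net K n0 (n1 :: ns) theta)
                     (\sum_(j < n0.+1) 'C(n1, j))%N /\
    at_least_bounded_regions (maxout_net K n0 (n1 :: ns) theta)
                     'C(n1.-1, n0)).
Proof.
move=> K2 n10 ns0; case: D => [|D] DE.
  suff : (0 < nparams K n0 (n1 :: ns))%N by rewrite -DE.
  have {DE} pos n ws : (0 < nparams K n ws)%N.
    by elim: ws n => //= m ws IH n; rewrite addn_gt0 IH orbT.
  exact: pos.
have gen : ae_leb (fun theta : 'rV[R]_D.+1 =>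
    generic n0 (first_layer n0 (Defs.coord theta) : 'I_n1 -> 'I_K -> nat -> R)).
  by apply: ae_generic; rewrite DE /= leq_addr.
have neq : ae_leb (fun theta : 'rV[R]_D.+1 => forall q q' : pattern K (n1 :: ns),
    q.1 <> q'.1 ->
    net_slope (Defs.coord theta) 0 n0 q 0 <> net_slope (Defs.coord theta) 0 n0 q' 0).
  apply: ae_forall => q; apply: ae_forall => q'.
  have [e|ne] := pselect (q.1 = q'.1); first exact: ae_true.
  by apply: ae_imply (@ae_slope_neq R K D n0 n1 ns q q' ns0 _ ne) => //; rewrite DE.
apply: ae_imply (ae_and gen neq) => theta [g ne].
exact: (generic_net_regions K2 g (fun _ => ne) n10).
Qed.

Theorem theorem2 (R : realType) (K n0 n1 : nat) (ns : seq nat) :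
  (2 <= K)%N -> (0 < n1)%N -> all (fun n => 0 < n)%N ns ->
  ae_leb (fun theta : 'rV[R]_(nparams K n0 (n1 :: ns)) =>
    at_least_regions (maxout_net K n0 (n1 :: ns) theta)
                     (\sum_(j < n0.+1) 'C(n1, j))%N /\
    at_least_bounded_regions (maxout_net K n0 (n1 :: ns) theta)
                     'C(n1.-1, n0)).
Proof. by move=> K2 n10 ns0; apply: ae_net_regions. Qed.
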